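(* Consider the single-source heterogeneous network (described in the context) with $n=2$ servers, arrival rates $\lambda_1,\lambda_2>0$ and service rates $\mu_1,\mu_2>0$. The average age of information at the monitor is $$\Delta=\frac{1}{\mu_1+\mu_2}+\frac{1}{\lambda_1+\lambda_2}+\frac{1}{(\mu_1+\mu_2)(\lambda_1+\lambda_2)}\left(\frac{\mu_1\lambda_2}{\lambda_1+\mu_2}+\frac{\mu_2\lambda_1}{\lambda_2+\mu_1}\right).$$
   Context: Network model: one information source, $n$ servers and a monitor. Updates arrive at server $j$ according to a Poisson process of rate $\lambda_j>0$, independent across servers; an update's generation time is its arrival time. Server $j$ transmits to the monitor with i.i.d. exponential service times of rate $\mu_j>0$. Each server uses LCFS with preemption in service: a new arrival immediately replaces the update in service; on service completion the update is delivered to the monitor and the server is idle until the next arrival. With $u(t)$ the largest generation time among updates delivered by time $t$, the age is $\Delta(t)=t-u(t)$ and the average age is $\Delta=\lim_{T\to\infty}\frac1T\int_0^T\Delta(t)dt$. *)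

(* Defs.v *)
From HB Require Import structures.
From mathcomp Require Import all_boot all_order all_algebra.
From mathcomp Require Import all_classical all_reals all_analysis.
Set Implicit Arguments. Unset Strict Implicit. Unset Printing Implicit Defensive.
Import Order.TTheory GRing.Theory Num.Theory.
Import numFieldNormedType.Exports.
Local Open Scope classical_set_scope.
Local Open Scope ring_scope.

Section model.
Context (d : measure_display) (T : measurableType d) (R : realType).

Definition is_exponential (P : probability T R) (X : T -> R) (rate : R) :=
  forall B : set R, measurable B ->
    P (X @^-1` B) = exponential_prob rate B.

Definition mutually_independent (I : eqType) (P : probability T R)
  (X : I -> T -> R) :=
  forall (s : seq I) (B : I -> set R), uniq s ->
    (forall i, measurable (B i)) ->
    P (\bigcap_(i in [set` s]) (X i @^-1` B i)) =
    (\prod_(i <- s) P (X i @^-1` B i))%E.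

(* Sample-path quantities, for a fixed outcome.
   A j k : k-th interarrival time at server j (time between the (k-1)-th
           and k-th arrival; arrival 0 happens at time A j 0 after time 0);
   S j k : service time drawn for the k-th arrival at server j. *)
Variable (n : nat) (A S : 'I_n -> nat -> R).

Definition gen_time (j : 'I_n) (k : nat) : R := \sum_(i < k.+1) A j i.

(* LCFS with preemption in service: the k-th update at server j is delivered
   iff its service completes before the next arrival at server j, in which
   case it reaches the monitor at time gen_time j k + S j k. *)
Definition delivered (j : 'I_n) (k : nat) : Prop := S j k < A j k.+1.
Definition delivery_time (j : 'I_n) (k : nat) : R := gen_time j k + S j k.

(* u(t): largest generation time among updates delivered by time t
   (0 if none, i.e. a fresh update is at the monitor at time 0) *)
Definition freshest (t : R) : R :=
  sup ([set 0] `|` [set g | exists j k, delivered j k /\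
                      delivery_time j k <= t /\ g = gen_time j k]).

Definition age (t : R) : R := t - freshest t.

Definition avg_age_upto (Tm : R) : \bar R :=
  let D : set R := [set` `[0, Tm]] in
  ((Tm^-1)%:E * \int[lebesgue_measure]_(t in D) (age t)%:E)%E.

End model.

(* Main.v *)
(* The age at time t is at least x <= t iff no server delivers by time t an update generated in
   ]t-x, t]. For one server, this event has the same probability at all times t >= x: a function of
   the generation time of the current update, harmonic for the renewal step "draw the service time
   and the next interarrival time", computes it as the tail at x of the sum of an exponential
   variable of rate mu_j and one of rate lam_j. The same method applied to two disjoint windows
   shows that the corresponding events are independent. As the servers are independent, the age has
   tail the product of two such tails, and its integral is the stated constant.
   For the time average, sample time with mesh h. Up to h, the age at time kh is h times the number
   of stale windows ](k-i-1)h, kh]. These counts have exponentially decaying covariances, because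
   windows ending at different times can be cut into disjoint ones, so they obey the strong law of
   large numbers (Chebyshev along squares). Finally h tends to 0 along the inverses of integers. *)

Require Import Defs.
From HB Require Import structures.
From mathcomp Require Import all_boot all_order all_algebra.
From mathcomp Require Import all_classical all_reals all_analysis.
From mathcomp Require Import measurable_realfun measurable_fun_approximation.
From mathcomp Require Import ring lra zify.
Import Order.TTheory GRing.Theory Num.Theory.
Import numFieldNormedType.Exports.
Local Open Scope classical_set_scope.
Local Open Scope ring_scope.
Set Implicit Arguments.
Unset Strict Implicit.
Unset Printing Implicit Defensive.

(** * Integrals of independent functions *)

Section independence.
Context d (T : measurableType d) (R : realType) (P : probability T R).

(** The network starts empty at time 0, yet staleness of ]t-x, t] has its limiting probability as
    soon as t >= x, so no convergence to stationarity has to be shown: the residual interarrival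
    time at t-x is exponential whatever came before, and once an update of the window has arrived
    the server stays busy until it delivers one, so that preemptions do not change the delivery
    rate. Staleness involves infinitely many updates. The indicator that the first n of them comply,
    multiplied by the harmonic function at the next generation time, keeps a constant mean in n. It
    converges to the indicator of the whole event, because generation times are unbounded and the
    function is 1 at late times; dominated convergence concludes. Windows that end at different
    times may overlap. Since only upper bounds on covariances matter, a long window may be replaced
    by the larger event that both of its pieces are stale. *)

Lemma independent_g_sigma_algebra (G : set (set T)) (F : set T) :
  setI_closed G -> G `<=` measurable -> measurable F ->
  (forall E, G E -> P (E `&` F) = (P E * P F)%E) ->
  forall E, <<s G >> E -> P (E `&` F) = (P E * P F)%E.
Proof.
move=> GI Gm mF GF E sE.
have r0 : 0 <= fine (P F) by exact: fine_ge0.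
have PF : (P F = (fine (P F))%:E)%E by rewrite fineK// fin_num_measure.
(* Both sides are finite measures of [E], so agreement on the pi-system [G] extends to the
   sigma-algebra that it generates. *)
pose m1 : {measure set T -> \bar R} := mrestr P mF.
pose m2 : {measure set T -> \bar R} := mscale (NngNum r0) P.
have GE : [set X | G X /\ X `<=` setT] = G.
  by apply/seteqP; split => [X []//|X GX]; split.
have := @g_sigma_algebra_measure_unique_trace _ R T G setT measurableT.
rewrite GE => /(_ Gm GI m1 m2).
have m12 X : (m2 X = P X * P F)%E by rewrite /m2/= /mscale/= -PF muleC.
have m11 X : (m1 X = P (X `&` F))%E by [].
move=> H; rewrite -m11 -m12; apply: H => //.
- by rewrite m12 m11 setTI probability_setT mul1e.
- by move=> A GA; rewrite m12 m11 GF.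
- by rewrite m11 setTI ltey_eq fin_num_measure.
Qed.

Context (I : eqType) (X : I -> T -> R).
Hypothesis mX : forall i, measurable_fun setT (X i).

Definition cylinder (J : set I) : set (set T) := [set E |
  exists (s : seq I) (B : I -> set R), [/\ [set` s] `<=` J,
    forall i, measurable (B i) &
    E = \bigcap_(i in [set` s]) (X i @^-1` B i)]].

Lemma cylinder_measurable J : cylinder J `<=` measurable.
Proof.
move=> _ [s [B [sJ mB ->]]]; apply: fin_bigcap_measurable => //.
move=> i _; rewrite -[_ @^-1` _]setTI; exact: mX.
Qed.

Lemma cylinder_setI J : setI_closed (cylinder J).
Proof.
move=> _ _ [s [B [sJ mB ->]]] [s' [B' [sJ' mB' ->]]].
exists (s ++ s'), (fun i => (if i \in s then B i else setT) `&`
                           (if i \in s' then B' i else setT)).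
split => [i /=|i|]; first by rewrite mem_cat => /orP[/sJ|/sJ'].
  by apply: measurableI; case: ifP.
apply/seteqP; split => w /=.
  move=> [Hs Hs'] i /= _; split; case: ifPn => // ii; [exact: Hs|exact: Hs'].
move=> H; split => i /= ii.
  by have /(_ _)[] := H i; rewrite /= ?mem_cat ?ii ?orbT.
by have /(_ _)[] := H i; rewrite /= ?mem_cat ?ii ?orbT.
Qed.

(** Uniqueness of measures is used once for each side, which leaves two cylinders, each on finitely
    many variables. *)
Lemma mutually_independent_disjoint (J K : set I) (E F : set T) :
  mutually_independent P X -> J `&` K = set0 ->
  <<s cylinder J >> E -> <<s cylinder K >> F ->
  P (E `&` F) = (P E * P F)%E.
Proof.
move=> indep JK sE sF.
have subm (L : set I) : <<s cylinder L >> `<=` measurable.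
  apply: smallest_sub; first exact: sigma_algebra_measurable.
  exact: cylinder_measurable.
apply: (independent_g_sigma_algebra (G := cylinder J)) => //.
- exact: cylinder_setI.
- exact: cylinder_measurable.
- exact: subm sF.
move=> {sE}E1 cE; rewrite setIC muleC.
apply: (independent_g_sigma_algebra (G := cylinder K)) => //.
- exact: cylinder_setI.
- exact: cylinder_measurable.
- exact: (cylinder_measurable cE).
case: cE => s [B [sJ mB ->]].
move=> {sF}F1 [s' [B' [sK mB' ->]]].
pose t := undup s; pose t' := undup s'.
have ts : [set` s] = [set` t] by apply/seteqP; split => i /=; rewrite mem_undup.
have ts' : [set` s'] = [set` t'].
  by apply/seteqP; split => i /=; rewrite mem_undup.
have disj i : i \in t' -> i \notin t.
  move=> it'; apply/negP => it.
  have : (J `&` K) i by split; [apply: sJ; rewrite ts|apply: sK; rewrite ts'].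
  by rewrite JK.
(* As the index lists are disjoint, the two families of Borel sets merge into one. *)
pose B2 i := if i \in t then B i else B' i.
have := indep (t' ++ t) B2; rewrite cat_uniq !undup_uniq andbT/= => H.
rewrite ts ts' (_ : \bigcap_(i in [set` t']) _ `&` _ =
   \bigcap_(i in [set` t' ++ t]) (X i @^-1` B2 i)).
  rewrite H; last 2 first.
  - by apply/hasPn => i it; apply/negP => /disj; rewrite it.
  - by move=> i; rewrite /B2; case: ifP.
  rewrite big_cat/= !indep ?undup_uniq//; congr (_ * _)%E.
  - by apply: eq_big_seq => i it; rewrite /B2 (negbTE (disj _ it)).
  - by apply: eq_big_seq => i it; rewrite /B2 it.
apply/seteqP; split => w /=.
  move=> [Hs Hs'] i /=; rewrite mem_cat => it; rewrite /B2.
  case: ifPn => [/Hs'//|nt]; move: it; rewrite (negbTE nt) orbF; exact: Hs.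
move=> H'; split => i /= ii.
  by have := H' i; rewrite /= mem_cat ii/= /B2 (negbTE (disj _ ii)); exact.
by have := H' i; rewrite /= mem_cat ii orbT/= /B2 ii; exact.
Qed.

(** That a function depends on the variables of [J] only is expressed as measurability for this
    smaller sigma-algebra, carried by an alias of [T]. *)
Lemma measurable_fun_cylinder (J : set I) (i : I) : J i ->
  measurable_fun setT (X i : g_sigma_algebraType (cylinder J) -> R).
Proof.
move=> Ji _ B mB; rewrite setTI; apply: sub_gen_smallest.
exists [:: i], (fun=> B); split => //.
  by move=> k /=; rewrite inE => /eqP ->.
apply/seteqP; split => [w Bw k /=|w].
  by rewrite inE => /eqP ->.
by move=> /(_ i); apply; rewrite /= inE.
Qed.

(* The inner integral uses an independent copy of [Y] because the joint law of [f] and [Y] is the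
   product of their laws. *)
Lemma integral_independent d' (T1 : measurableType d') (f : T -> T1)
    (Y : {mfun T >-> R}) (Q : probability R R)
    (F : T1 * R -> \bar R) :
  measurable_fun setT f ->
  (forall C B, measurable C -> measurable B ->
    P (f @^-1` C `&` Y @^-1` B) = (P (f @^-1` C) * P (Y @^-1` B))%E) ->
  (forall B, measurable B -> P (Y @^-1` B) = Q B) ->
  measurable_fun setT F -> (forall z, (0 <= F z)%E) ->
  (\int[P]_w F (f w, Y w) = \int[P]_w \int[Q]_y F (f w, y))%E.
Proof.
move=> mf ind YQ mF F0.
pose mixin := isMeasurableFun.Build _ _ _ _ f mf.
pose f' : {mfun T >-> T1} := HB.pack f mixin.
pose fY := fun w => (f w, Y w).
have mfY : measurable_fun setT fY by exact: measurable_fun_pair.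
pose mixin2 := isMeasurableFun.Build _ _ _ _ fY mfY.
pose fY' : {mfun T >-> (T1 * R)%type} := HB.pack fY mixin2.
have -> : (\int[P]_w F (f w, Y w) = \int[distribution P fY']_z F z)%E.
  by rewrite ge0_integral_distribution.
rewrite (@eq_measure_integral _ _ _ _ (distribution P f' \x Q)%E); last first.
  move=> C mC _; apply/esym; apply: product_measure_unique => // A B mA mB.
  transitivity (P (f @^-1` A) * P (Y @^-1` B))%E; first exact: ind.
  by congr (_ * _)%E; exact: YQ.
rewrite fubini_tonelli1//= ge0_integral_distribution//.
- exact: measurable_fun_fubini_tonelli_F.
- by move=> y; rewrite /fubini_F; apply: integral_ge0.
Qed.

End independence.

Lemma measurable_fun_EFin d (T : measurableType d) (R : realType) (D : set T)
    (f : T -> R) :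
  measurable_fun D f -> measurable_fun D (fun x => (f x)%:E).
Proof. by move=> mf; apply/measurable_EFinP. Qed.

Section projections.
Context d1 d2 (T1 : measurableType d1) (T2 : measurableType d2) d'
  (T' : measurableType d') (g : T' -> T1 * T2).
Hypothesis mg : measurable_fun setT g.

Lemma measurable_fun_fst : measurable_fun setT (fun z => (g z).1).
Proof. exact: (measurableT_comp (@measurable_fst _ _ T1 T2)). Qed.

Lemma measurable_fun_snd : measurable_fun setT (fun z => (g z).2).
Proof. exact: (measurableT_comp (@measurable_snd _ _ T1 T2)). Qed.

End projections.

(** * Products along the updates of one server *)

Section arrivals.
Context {R : realType}.

Definition arrival {T : Type} (A : nat -> T -> R) (k : nat) (w : T) : R :=
  \sum_(i < k.+1) A i w.

(** One factor per update. Indicators as factors give the indicator that the first [k] updates all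
    behave as required. *)
Definition weight {T : Type} (f : R -> R -> R -> R) (A S : nat -> T -> R)
    (k : nat) (w : T) : R :=
  \prod_(i < k) f (arrival A i w) (S i w) (A i.+1 w).

Lemma arrivalS {T : Type} (A : nat -> T -> R) k w :
  arrival A k.+1 w = arrival A k w + A k.+1 w.
Proof. by rewrite /arrival big_ord_recr. Qed.

Lemma weightS {T : Type} f (A S : nat -> T -> R) k w :
  weight f A S k.+1 w =
  weight f A S k w * f (arrival A k w) (S k w) (A k.+1 w).
Proof. by rewrite /weight big_ord_recr. Qed.

Context {d} {T : measurableType d}.
Implicit Types A S : nat -> T -> R.

Lemma measurable_arrival A k :
  (forall i, (i <= k)%N -> measurable_fun setT (A i)) ->
  measurable_fun setT (arrival A k).
Proof.
move=> mA; apply: measurable_sum => i; apply: mA; rewrite -ltnS; exact: ltn_ord.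
Qed.

Lemma measurable_weight (f : R -> R -> R -> R) A S k :
  measurable_fun setT (fun z : R * R * R => f z.1.1 z.1.2 z.2) ->
  (forall i, (i <= k)%N -> measurable_fun setT (A i)) ->
  (forall i, (i < k)%N -> measurable_fun setT (S i)) ->
  measurable_fun setT (weight f A S k).
Proof.
move=> mf mA mS; apply: measurable_prod => i _.
apply: (measurableT_comp (f := fun z : R * R * R => f z.1.1 z.1.2 z.2)
  (g := fun w => (arrival A i w, S i w, A i.+1 w))) => //.
apply: measurable_fun_pair; last exact/mA/ltn_ord.
apply: measurable_fun_pair; last exact/mS/ltn_ord.
apply: measurable_arrival => l li; apply: mA.
by rewrite (leq_trans li)// ltnW// ltn_ord.
Qed.

End arrivals.

Section weighted_arrivals.
Context d (T : measurableType d) (R : realType) (P : probability T R)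
  (I : eqType) (X : I -> {mfun T >-> R}) (iA iS : nat -> I)
  (QA QS : probability R R).
Hypotheses (indep : mutually_independent P (fun i => X i : T -> R))
  (iA_inj : injective iA) (iS_inj : injective iS)
  (iAS : forall k l, iA k <> iS l)
  (lawA : forall k B, measurable B -> P (X (iA k) @^-1` B) = QA B)
  (lawS : forall k B, measurable B -> P (X (iS k) @^-1` B) = QS B).

Let A k : T -> R := X (iA k).
Let S k : T -> R := X (iS k).
Let mX i : measurable_fun setT (X i : T -> R). Proof. by []. Qed.

Lemma independent_of_other_variables d' (T1 : measurableType d') (i : I)
    (f : T -> T1) :
  measurable_fun setT
    (f : g_sigma_algebraType (cylinder (fun i => X i : T -> R) [set~ i]) -> T1) ->
  measurable_fun setT f /\
  forall C B, measurable C -> measurable B ->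
    P (f @^-1` C `&` X i @^-1` B) = (P (f @^-1` C) * P (X i @^-1` B))%E.
Proof.
move=> mf.
have sub : <<s cylinder (fun i => X i : T -> R) [set~ i] >> `<=` measurable.
  apply: smallest_sub; first exact: sigma_algebra_measurable.
  exact: cylinder_measurable.
split=> [_ B mB|C B mC mB].
  by apply: sub; have := mf measurableT B mB.
apply: (mutually_independent_disjoint mX (J := [set~ i]) (K := [set i])) => //.
- by rewrite setICl.
- by have := mf measurableT C mC; rewrite setTI.
- have := measurable_fun_cylinder (X := fun i => X i : T -> R) (J := [set i]).
  by move=> /(_ i erefl measurableT B mB); rewrite setTI.
Qed.

Variables (kappa : R -> R -> R) (ok : R -> R -> R -> R) (v : R -> R) (r : R).
Hypotheses (mok : measurable_fun setT (fun z : R * R * R => ok z.1.1 z.1.2 z.2))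
  (mkappa : measurable_fun setT (fun z : R * R => kappa z.1 z.2))
  (mv : measurable_fun setT v)
  (ok0 : forall s x y, 0 <= ok s x y) (kappa0 : forall s y, 0 <= kappa s y)
  (v0 : forall s, 0 <= v s) (r0 : 0 <= r).
Hypothesis okE : forall s y,
  (\int[QS]_x (ok s x y)%:E = (kappa s y)%:E)%E.
Hypothesis vE : forall s,
  (\int[QA]_y (kappa s y * v (s + y))%:E = (r * v s)%:E)%E.

Let weight0 k w : 0 <= weight ok A S k w.
Proof. exact: prodr_ge0. Qed.

(** The last factor brings in [S k] and [A k.+1], independent of each other and of the rest.
    Averaging over the service time turns [ok] into [kappa]; averaging over the interarrival time
    then applies the eigenfunction equation [vE]. *)
Lemma integral_weight_step k :
  (\int[P]_w (weight ok A S k.+1 w * v (arrival A k.+1 w))%:E =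
   r%:E * \int[P]_w (weight ok A S k w * v (arrival A k w))%:E)%E.
Proof.
under eq_integral => w _ do rewrite weightS arrivalS.
have mA' i j : iA i <> j ->
    measurable_fun setT (A i : g_sigma_algebraType
      (cylinder (fun i => X i : T -> R) [set~ j]) -> R).
  by move=> ij; apply: (measurable_fun_cylinder
    (X := fun i => X i : T -> R)) => /= E; exact: ij.
have mS' i j : iS i <> j ->
    measurable_fun setT (S i : g_sigma_algebraType
      (cylinder (fun i => X i : T -> R) [set~ j]) -> R).
  by move=> ij; apply: (measurable_fun_cylinder
    (X := fun i => X i : T -> R)) => /= E; exact: ij.
pose f1 w := (weight ok A S k w, arrival A k w).
pose f2 w := (f1 w, A k.+1 w).
(* The absolute value makes [F2] nonnegative on the whole product space, as Tonelli requires; on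
   actual weights it is the identity. *)
pose F2 (z : R * R * R * R) : \bar R :=
  (`|z.1.1.1| * ok z.1.1.2 z.2 z.1.2 * v (z.1.1.2 + z.1.2))%:E.
pose F1 (z : R * R * R) : \bar R :=
  (`|z.1.1| * kappa z.1.2 z.2 * v (z.1.2 + z.2))%:E.
have [|mf2 indf2] := @independent_of_other_variables _ _ (iS k) f2.
  apply: measurable_fun_pair; last by apply: mA'; exact: iAS.
  apply: measurable_fun_pair.
    apply: measurable_weight => //.
      by move=> i ik; apply: mA'; exact: iAS.
    by move=> i ik; apply: mS' => /iS_inj E; move: ik; rewrite E ltnn.
  by apply: measurable_arrival => i ik; apply: mA'; exact: iAS.
have [|mf1 indf1] := @independent_of_other_variables _ _ (iA k.+1) f1.
  apply: measurable_fun_pair.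
    apply: measurable_weight => //.
      by move=> i ik; apply: mA' => /iA_inj E; move: ik; rewrite E ltnn.
    by move=> i ik; apply: mS' => /esym; exact: iAS.
  by apply: measurable_arrival => i ik; apply: mA' => /iA_inj E;
    move: ik; rewrite E ltnn.
have vD d' (T' : measurableType d') (g h : T' -> R) :
    measurable_fun setT g -> measurable_fun setT h ->
    measurable_fun setT (fun z => v (g z + h z)).
  by move=> mg mh; apply: (measurableT_comp mv); exact: measurable_funD.
have mF2 : measurable_fun setT F2.
  apply: measurable_fun_EFin; apply: measurable_funM; last first.
    apply: vD; first by apply: measurable_fun_snd; do 2 apply: measurable_fun_fst.
    by apply: measurable_fun_snd; apply: measurable_fun_fst.
  apply: measurable_funM; first by apply: measurableT_comp => //; do 3 apply: measurable_fun_fst.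
  apply: (measurableT_comp (f := fun z : R * R * R => ok z.1.1 z.1.2 z.2)
    (g := fun z : R * R * R * R => (z.1.1.2, z.2, z.1.2))) => //.
  apply: measurable_fun_pair; last by apply: measurable_fun_snd; apply: measurable_fun_fst.
  apply: measurable_fun_pair; last exact: measurable_fun_snd.
  by apply: measurable_fun_snd; do 2 apply: measurable_fun_fst.
have mF1 : measurable_fun setT F1.
  apply: measurable_fun_EFin; apply: measurable_funM; last first.
    apply: vD; first by apply: measurable_fun_snd; apply: measurable_fun_fst.
    exact: measurable_fun_snd.
  apply: measurable_funM; first by apply: measurableT_comp => //; do 2 apply: measurable_fun_fst.
  apply: (measurableT_comp (f := fun z : R * R => kappa z.1 z.2)
    (g := fun z : R * R * R => (z.1.2, z.2))) => //.
  apply: measurable_fun_pair; last exact: measurable_fun_snd.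
  by apply: measurable_fun_snd; apply: measurable_fun_fst.
transitivity (\int[P]_w F2 (f2 w, X (iS k) w))%E.
  by apply: eq_integral => w _; rewrite /F2/= ger0_norm.
have meas_okx s y : measurable_fun setT (fun x => ok s x y).
  apply: (measurableT_comp (f := fun z : R * R * R => ok z.1.1 z.1.2 z.2)
    (g := fun x : R => (s, x, y))) => //.
  apply: measurable_fun_pair; last exact: measurable_cst.
  apply: measurable_fun_pair; [exact: measurable_cst|exact: measurable_id].
have meas_kappay s : measurable_fun setT (fun y => kappa s y).
  apply: (measurableT_comp (f := fun z : R * R => kappa z.1 z.2)
    (g := fun y : R => (s, y))) => //.
  apply: measurable_fun_pair; [exact: measurable_cst|exact: measurable_id].
rewrite (integral_independent mf2 indf2 (lawS k) mF2); last first.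
  by move=> z; rewrite /F2 /F1 lee_fin !mulr_ge0.
transitivity (\int[P]_w F1 (f1 w, X (iA k.+1) w))%E.
  apply: eq_integral => w _; rewrite /F2 /F1/= ger0_norm//.
  under eq_integral => x _ do rewrite mulrAC EFinM.
  rewrite ge0_integralZl//=.
  - by rewrite okE -EFinM mulrAC.
  - by apply: measurable_fun_EFin; exact: meas_okx.
  - by move=> x _; rewrite lee_fin.
  - by rewrite lee_fin mulr_ge0.
rewrite (integral_independent mf1 indf1 (lawA k.+1) mF1); last first.
  by move=> z; rewrite /F2 /F1 lee_fin !mulr_ge0.
rewrite -ge0_integralZl//=; last 2 first.
- apply: measurable_fun_EFin; apply: measurable_funM.
    by have := measurable_fun_fst mf1.
  by apply: (measurableT_comp mv); have := measurable_fun_snd mf1.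
- by move=> w _; rewrite lee_fin mulr_ge0.
apply: eq_integral => w _; rewrite /F1/= ger0_norm//.
under eq_integral => x _ do rewrite -mulrA EFinM.
rewrite ge0_integralZl//=.
- by rewrite vE -EFinM mulrCA.
- apply: measurable_fun_EFin; apply: measurable_funM => //.
  exact: vD.
- by move=> x _; rewrite lee_fin mulr_ge0.
- by rewrite lee_fin.
Qed.

(** Used with [r = 1], where the mean stays constant in [k], and with [r < 1], where it decays
    geometrically. *)
Lemma integral_weight k :
  (\int[P]_w (weight ok A S k w * v (arrival A k w))%:E =
   (r ^+ k)%:E * \int[QA]_y (v y)%:E)%E.
Proof.
elim: k => [|k IH].
  rewrite expr0 mul1e.
  under eq_integral => w _ do
    rewrite /weight big_ord0 mul1r /arrival big_ord_recl big_ord0 addr0/=.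
  rewrite (@eq_measure_integral _ _ _ _ (distribution P (X (iA 0%N)))); last first.
    by move=> B mB _; exact/esym/lawA.
  by rewrite ge0_integral_distribution//; exact: measurable_fun_EFin.
by rewrite integral_weight_step IH muleA -EFinM -exprS.
Qed.

End weighted_arrivals.

(** * Exponential laws *)

Section exponential_law.
Context {R : realType} (Q : probability R R) (lam : R).
Hypotheses (lam0 : 0 < lam)
  (QE : forall B, measurable B -> Q B = exponential_prob lam B).
Local Notation mu := (@lebesgue_measure R).

(* The reals carry two displays for the same Borel sets: the default one and that of
   [measurableTypeR], on which the Lebesgue measure lives. *)
Lemma integral_exponential (g : R -> R) :
  Q.-integrable setT (EFin \o g) ->
  (\int[Q]_x (g x)%:E = \int[mu]_x ((g x)%:E * (exponential_pdf lam x)%:E))%E.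
Proof.
move=> ig.
have mid : measurable_fun setT (idfun : R -> measurableTypeR R).
  by move=> _ B mB; rewrite setTI; exact: mB.
pose mixin := isMeasurableFun.Build _ _ _ _ _ mid.
pose id' : {mfun R >-> measurableTypeR R} := HB.pack idfun mixin.
pose Q' : probability (measurableTypeR R) R := distribution Q id'.
have Q'E B : measurable B -> Q' B = exponential_prob lam B by exact: QE.
have mg : measurable_fun setT (EFin \o g : measurableTypeR R -> \bar R).
  exact: measurable_int ig.
transitivity (\int[Q']_x (g x)%:E)%E.
  by rewrite integral_distribution.
have {}ig : Q'.-integrable setT (EFin \o g).
  apply/integrableP; split; first exact: mg.
  have /integrableP[_] := ig.
  rewrite ge0_integral_distribution//.
  exact: measurableT_comp.
have dom : Q' `<< mu.
  apply/null_content_dominatesP => B mB mB0; rewrite Q'E// /exponential_prob.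
  by rewrite null_set_integral//; apply: measurable_fun_EFin; 
    apply: measurable_funTS; exact: measurable_exponential_pdf.
rewrite -(Radon_Nikodym_change_of_variables dom)//=.
have mpdf : measurable_fun setT (EFin \o exponential_pdf lam).
  by apply/measurable_EFinP; exact: measurable_exponential_pdf.
apply: ae_eq_integral => //.
- apply: emeasurable_funM; first exact: mg.
  by apply: (measurable_int mu); exact: Radon_Nikodym_integrable.
- by apply: emeasurable_funM => //; exact: mg.
(* The Radon-Nikodym derivative and the exponential density have the same integral over every Borel
   set. *)
- apply: ae_eqe_mul2l => /=.
  rewrite Radon_NikodymE//=.
  case: cid => /= k [k1 k2 k3].
  apply: integral_ae_eq => //=.
  by move=> E _ mE; rewrite -k3//; exact: Q'E.
Qed.
Lemma exponential_le0 : Q `]-oo, 0]%classic = 0%E.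
Proof.
rewrite QE// /exponential_prob -integral_itv_bndo_bndc; last first.
  apply: measurable_fun_EFin; apply: measurable_funTS.
  exact: measurable_exponential_pdf.
rewrite integral0_eq// => x /=; rewrite in_itv/= => x0.
by rewrite lt0_exponential_pdf.
Qed.

(** The law has no atom, so both kinds of right end are treated at once; [integral_meets_deadline]
    meets an interval whose end is open or closed according to a comparison. *)
Lemma exponential_lt (b : bool) (x : R) :
  Q [set` Interval -oo%O (BSide b x)] = (1 - expR (- lam * Num.max 0 x))%:E.
Proof.
have [x0|x0] := leP x 0.
  rewrite mulr0 expR0 subrr; apply: (subset_measure0 _ _ _ exponential_le0) => //.
  by apply: subset_itvl; case: b; rewrite bnd_simp.
have -> : Q [set` Interval -oo%O (BSide b x)] = Q `]-oo, x]%classic.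
  case: b => //; rewrite !QE// /exponential_prob integral_itv_bndo_bndc//.
  apply: measurable_fun_EFin; apply: measurable_funTS.
  exact: measurable_exponential_pdf.
have -> : `]-oo, x]%classic = `]-oo, 0[%classic `|` `[0, x]%classic :> set R.
  rewrite -itv_bndbnd_setU// ?bnd_simp//; exact: ltW.
rewrite measureU//; last first.
  apply/seteqP; split => y //=; rewrite !in_itv/= => -[y0 /andP[y1 _]].
  by move: y1; rewrite leNgt y0.
rewrite [X in (X + _)%E](_ : _ = 0%E); last first.
  by apply: (subset_measure0 _ _ _ exponential_le0) => //;
    apply: subset_itvl; rewrite bnd_simp.
rewrite add0e.
transitivity (exponential_prob lam `[0, x]); first exact: QE.
exact: exponential_prob_itv0c.
Qed.

Lemma exponential_gt (x : R) :
  Q `]x, +oo[%classic = (expR (- lam * Num.max 0 x))%:E.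
Proof.
have := probability_setC Q (measurable_itv `]-oo, x]).
rewrite setCitvl exponential_lt => ->.
by rewrite EFinB oppeB// addeA subee// add0e.
Qed.

(** The excess over [c] is 0 when [c] is not exceeded and otherwise has the original law: its law is
    a mixture of a Dirac mass at 0 and of [Q]. *)
Lemma exponential_memoryless (c : R) (g : R -> R) : 0 <= c ->
  measurable_fun setT g -> (forall x, 0 <= g x) ->
  (\int[Q]_x (g (Num.max (x - c) 0))%:E =
   ((1 - expR (- lam * c)) * g 0)%:E +
   (expR (- lam * c))%:E * \int[Q]_x (g x)%:E)%E.
Proof.
move=> c0 mg g0.
pose sh (x : R) := Num.max (x - c) 0.
have msh : measurable_fun setT sh.
  by apply: measurable_maxr => //; exact: measurable_funB.
have p0 : 0 <= expR (- lam * c) by exact: expR_ge0.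
have q0 : 0 <= 1 - expR (- lam * c).
  by rewrite subr_ge0 -expR0 ler_expR mulNr oppr_le0 mulr_ge0// ltW.
pose m2 := measure_add (mscale (NngNum q0) \d_(0 : R)) (mscale (NngNum p0) Q).
pose mixin := isMeasurableFun.Build _ _ _ _ sh msh.
pose sh' : {mfun R >-> R} := HB.pack sh mixin.
transitivity (\int[distribution Q sh']_x (g x)%:E)%E.
  by rewrite ge0_integral_distribution//; exact: measurable_fun_EFin.
have m2E (B : set R) : m2 B = ((1 - expR (- lam * c))%:E * \d_(0%R : R) B +
    (expR (- lam * c))%:E * Q B)%E by rewrite /m2 measure_addE.
rewrite (@eq_measure_integral _ _ _ _ m2); last first.
  move=> B mB _.
  apply: (measure_unique (@RGenInftyO.G R) (fun n => `]-oo, n%:R[%classic)) => //.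
  - exact: RGenInftyO.measurableE.
  - move=> _ _ [x ->] [y ->]; exists (Num.min x y).
    apply/seteqP; split => z /=; rewrite !in_itv/= lt_min.
      by move=> [-> ->].
    by move=> /andP.
  - by move=> i; exists i%:R.
  - apply/seteqP; split => // x _; exists (Num.trunc x).+1 => //=.
    by rewrite in_itv/= truncnS_gt.
  - move=> _ [x ->]; rewrite -[RHS]/(m2 _) m2E diracE mem_setE in_itv/=.
    rewrite exponential_lt.
    have [x0|x0] := ltP 0 x.
      rewrite mule1.
      have -> : distribution Q sh' `]-oo, x[%classic = Q `]-oo, x + c[%classic.
        apply: (congr1 (fun B => Q B)); apply/seteqP; split => z /=; rewrite !in_itv/= /sh gt_max x0 andbT ltrBlDr //.
      rewrite exponential_lt max_r; last by rewrite addr_ge0// ltW.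
      rewrite -EFinM -EFinD; congr EFin.
      by rewrite mulrDr expRD; ring.
    rewrite mulr0 expR0 subrr mule0 mule0 adde0.
    rewrite -(measure0 Q).
    apply: (congr1 (fun B => Q B)); apply/seteqP; split => z //=; rewrite in_itv/= /sh gt_max.
    by move=> /andP[_]; rewrite ltNge x0.
  - by move=> k; apply: (le_lt_trans (probability_le1 _ _)) => //; exact: ltry.
rewrite ge0_integral_measure_add//; last exact: measurable_fun_EFin.
rewrite !ge0_integral_mscale//; try exact: measurable_fun_EFin.
rewrite integral_dirac//; last exact: measurable_fun_EFin.
rewrite diracT mul1e -EFinM//.
all: by move=> x _; rewrite lee_fin.
Qed.

End exponential_law.

(** * Tails of two-stage lifetimes *)

Section derivatives.
Context {R : realType}.
Implicit Types (f g : R -> R) (x : R).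

Lemma is_derive_addf f g x df dg :
  is_derive x 1 f df -> is_derive x 1 g dg ->
  is_derive x 1 (fun y => f y + g y) (df + dg).
Proof. by move=> ? ?; exact: is_deriveD. Qed.

Lemma is_derive_oppf f x df :
  is_derive x 1 f df -> is_derive x 1 (fun y => - f y) (- df).
Proof. by move=> ?; exact: is_deriveN. Qed.

Lemma is_derive_mulf f g x df dg :
  is_derive x 1 f df -> is_derive x 1 g dg ->
  is_derive x 1 (fun y => f y * g y) (df * g x + f x * dg).
Proof.
move=> ? ?; rewrite [X in is_derive _ _ _ X](_ : _ = f x *: dg + g x *: df).
  exact: is_deriveM.
by rewrite addrC [df * _]mulrC.
Qed.

Lemma is_derive_expRZ (c x : R) :
  is_derive x 1 (fun y => expR (c * y)) (c * expR (c * x)).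
Proof.
have dc : is_derive x 1 (fun y => c * y) (0 * x + c * 1).
  exact: is_derive_mulf.
rewrite [X in is_derive _ _ _ X](_ : _ = expR (c * x) * (0 * x + c * 1)).
  exact: (is_derive1_comp (f := expR) (g := fun y => c * y)).
by rewrite mul0r add0r mulr1 mulrC.
Qed.

Lemma is_derive_mean_value f (df : R -> R) a b : a <= b ->
  (forall x, is_derive x 1 f (df x)) ->
  exists2 c, a <= c <= b & f b - f a = df c * (b - a).
Proof.
move=> ab fdf.
have cf : continuous f.
  by move=> x; apply: differentiable_continuous; apply/derivable1_diffP.
have [//|c] := @MVT_segment R f df a b ab.
  exact: continuous_subspaceT.
by rewrite in_itv/= => cab E; exists c.
Qed.

Lemma is_derive_ge0_le f (df : R -> R) a b : 0 <= a -> a <= b ->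
  (forall x, is_derive x 1 f (df x)) -> (forall x, 0 <= x -> 0 <= df x) ->
  f a <= f b.
Proof.
move=> a0 ab fdf df0; have [c /andP[ac cb] E] := is_derive_mean_value ab fdf.
rewrite -subr_ge0 E mulr_ge0 ?subr_ge0// df0//; exact: le_trans ac.
Qed.

End derivatives.

Section two_stage.
Context {R : realType}.
Implicit Types l m c x : R.

(* The antiderivative of [fun x => expR (c * x)] vanishing at [0], including the case [c = 0]. *)
Definition primexp c x : R := if c == 0 then x else (expR (c * x) - 1) / c.

Lemma is_derive_primexp c x : is_derive x 1 (primexp c) (expR (c * x)).
Proof.
rewrite /primexp; case: (eqVneq c 0) => [->|c0].
  by rewrite mul0r expR0; exact: is_derive_id.
rewrite [X in is_derive _ _ _ X](_ : _ =
  (c * expR (c * x) + 0) * c^-1 + (expR (c * x) - 1) * 0); last first.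
  by rewrite addr0 mulr0 addr0 mulrAC mulfV// mul1r.
apply: is_derive_mulf; apply: is_derive_addf; exact: is_derive_expRZ.
Qed.

Lemma primexp0 c : primexp c 0 = 0.
Proof. by rewrite /primexp mulr0 expR0 subrr mul0r if_same. Qed.

Lemma expR_primexp c x : expR (c * x) = 1 + c * primexp c x.
Proof.
rewrite /primexp; case: eqVneq => [->|c0]; first by rewrite !mul0r expR0 addr0.
by rewrite mulrCA mulfV// mulr1 addrCA subrr addr0.
Qed.

Lemma primexp_ge0 c x : 0 <= x -> 0 <= primexp c x.
Proof.
move=> x0; rewrite -(primexp0 c).
apply: (is_derive_ge0_le (lexx 0) x0 (is_derive_primexp c)) => // y _.
Qed.

(* The tail of the sum of two independent exponential variables of rates [l] and [m]. *)
Definition hypoexp l m x : R := expR (- m * x) * (1 + m * primexp (m - l) x).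

Lemma hypoexp0 l m : hypoexp l m 0 = 1.
Proof. by rewrite /hypoexp mulr0 expR0 primexp0 mulr0 addr0 mulr1. Qed.

Lemma is_derive_hypoexp l m x :
  is_derive x 1 (hypoexp l m) (- m * hypoexp l m x + m * expR (- l * x)).
Proof.
rewrite [X in is_derive _ _ _ X](_ : _ =
  - m * expR (- m * x) * (1 + m * primexp (m - l) x) +
  expR (- m * x) * (0 + (0 * primexp (m - l) x + m * expR ((m - l) * x)))).
  apply: is_derive_mulf; first exact: is_derive_expRZ.
  apply: is_derive_addf; apply: is_derive_mulf; exact: is_derive_primexp.
have -> : - l * x = - m * x + (m - l) * x by ring.
by rewrite expRD /hypoexp; ring.
Qed.

(** For nonnegative [x] this is the probability that the first stage has ended by [x] and the second
    has not. Its sign gives the monotonicity of [hypoexp]. *)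
Lemma hypoexpBexpR l m x :
  hypoexp l m x - expR (- l * x) = l * (expR (- m * x) * primexp (m - l) x).
Proof.
have -> : - l * x = - m * x + (m - l) * x by ring.
by rewrite expRD expR_primexp /hypoexp; ring.
Qed.

Lemma hypoexp_ge0 l m x : 0 < m -> 0 <= x -> 0 <= hypoexp l m x.
Proof.
move=> m0 x0; rewrite mulr_ge0 ?expR_ge0// addr_ge0// mulr_ge0 ?primexp_ge0//.
exact: ltW.
Qed.

Lemma hypoexp_nonincreasing l m x y : 0 < l -> 0 < m -> 0 <= x -> x <= y ->
  hypoexp l m y <= hypoexp l m x.
Proof.
move=> l0 m0 x0 xy; rewrite -lerN2.
pose f (z : R) : R := - hypoexp l m z.
pose df (z : R) : R := - (- m * hypoexp l m z + m * expR (- l * z)).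
have dfE (z : R) : is_derive z 1 f (df z).
  by apply: is_derive_oppf; exact: is_derive_hypoexp.
apply: (is_derive_ge0_le x0 xy dfE) => z z0.
rewrite /df opprD mulNr opprK -mulrBr hypoexpBexpR.
by rewrite !mulr_ge0 ?expR_ge0 ?primexp_ge0 ?(ltW l0) ?(ltW m0).
Qed.

Lemma hypoexp_le_expR l m c x : 0 < m -> 0 <= c -> c <= l -> c < m -> 0 <= x ->
  hypoexp l m x <= m / (m - c) * expR (- c * x).
Proof.
move=> m0 c0 cl cm x0; have mc : 0 < m - c by rewrite subr_gt0.
(* [f x - 1] is the difference of the two sides multiplied by [expR (m * x)]; its derivative has an
   evident sign. *)
pose f (z : R) : R := m / (m - c) * expR ((m - c) * z) + - m * primexp (m - l) z.
suff : 1 <= f x.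
  rewrite -subr_ge0 => fx; rewrite -subr_ge0.
  rewrite (_ : _ - _ = expR (- m * x) * (f x - 1)) ?mulr_ge0 ?expR_ge0//.
  rewrite /f /hypoexp; have -> : - c * x = - m * x + (m - c) * x by ring.
  by rewrite expRD; ring.
apply: (@le_trans _ _ (f 0)).
  rewrite /f primexp0 !mulr0 expR0 addr0 mulr1 ler_pdivlMr// mul1r.
  by rewrite lerBlDr lerDl.
pose df (z : R) : R := (0 * expR ((m - c) * z) +
    m / (m - c) * ((m - c) * expR ((m - c) * z))) +
  (0 * primexp (m - l) z + - m * expR ((m - l) * z)).
have dfE (z : R) : is_derive z 1 f (df z).
  apply: is_derive_addf; apply: is_derive_mulf; first exact: is_derive_expRZ.
  exact: is_derive_primexp.
apply: (is_derive_ge0_le (lexx 0) x0 dfE) => z z0.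
rewrite /df !mul0r !add0r mulrA divfK ?gt_eqF// mulNr subr_ge0 ler_pM2l//.
by rewrite ler_expR ler_wpM2r// lerB.
Qed.

(** * The mean age as an antiderivative *)

Section mean_age.
Variables (l1 l2 m1 m2 : R).
Hypotheses (l10 : 0 < l1) (l20 : 0 < l2) (m10 : 0 < m1) (m20 : 0 < m2).

Definition age_tail x : R := hypoexp l1 m1 x * hypoexp l2 m2 x.

(* The products of a function of index 1 and one of index 2 span a space on which derivation is
   triangular; inverting it gives these coefficients of the integral of [age_tail] over
   [x, +oo[. *)
Definition age_tail_integral x : R :=
  let g1 := expR (- l1 * x) in let g2 := expR (- l2 * x) in
  let h1 := hypoexp l1 m1 x in let h2 := hypoexp l2 m2 x in
  let a := (m1 + m2)^-1 in
  let b := a * m1 / (l1 + m2) in let c := a * m2 / (l2 + m1) in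
  a * (h1 * h2) + b * (g1 * h2) + c * (h1 * g2)
  + (b * m2 + c * m1) / (l1 + l2) * (g1 * g2).

Lemma is_derive_age_tail_integral x :
  is_derive x 1 age_tail_integral (- age_tail x).
Proof.
have dg l : is_derive x 1 (fun y => expR (- l * y)) (- l * expR (- l * x)).
  exact: is_derive_expRZ.
have dh l m := is_derive_hypoexp l m x.
pose a := (m1 + m2)^-1.
pose b := a * m1 / (l1 + m2). pose c := a * m2 / (l2 + m1).
pose e := (b * m2 + c * m1) / (l1 + l2).
have dZ k (f : R -> R) df : is_derive x 1 f df ->
    is_derive x 1 (fun y => k * f y) (0 * f x + k * df).
  by move=> ?; exact: is_derive_mulf.
have D := is_derive_addf (is_derive_addf (is_derive_addf
  (dZ a _ _ (is_derive_mulf (dh l1 m1) (dh l2 m2)))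
  (dZ b _ _ (is_derive_mulf (dg l1) (dh l2 m2))))
  (dZ c _ _ (is_derive_mulf (dh l1 m1) (dg l2))))
  (dZ e _ _ (is_derive_mulf (dg l1) (dg l2))).
have {}D : is_derive x 1 age_tail_integral _ := D.
apply: (is_derive_eq D).
rewrite /age_tail /e /c /b /a.
set h1 := hypoexp l1 m1 x; set h2 := hypoexp l2 m2 x.
set g1 := expR (- l1 * x); set g2 := expR (- l2 * x).
have : m1 + m2 != 0 by rewrite gt_eqF// addr_gt0.
have : l1 + m2 != 0 by rewrite gt_eqF// addr_gt0.
have : l2 + m1 != 0 by rewrite gt_eqF// addr_gt0.
have : l1 + l2 != 0 by rewrite gt_eqF// addr_gt0.
move=> n1 n2 n3 n4; field.
by rewrite n1 n2 n3 n4.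
Qed.

Lemma age_tail_integral0 : age_tail_integral 0 =
  (m1 + m2)^-1 + (l1 + l2)^-1 + ((m1 + m2) * (l1 + l2))^-1
       * (m1 * l2 / (l1 + m2) + m2 * l1 / (l2 + m1)).
Proof.
rewrite /age_tail_integral !hypoexp0 !mulr0 expR0 !mulr1.
have : m1 + m2 != 0 by rewrite gt_eqF// addr_gt0.
have : l1 + m2 != 0 by rewrite gt_eqF// addr_gt0.
have : l2 + m1 != 0 by rewrite gt_eqF// addr_gt0.
have : l1 + l2 != 0 by rewrite gt_eqF// addr_gt0.
move=> n1 n2 n3 n4; field.
by rewrite n1 n2 n3 n4.
Qed.

Lemma age_tail_ge0 x : 0 <= x -> 0 <= age_tail x.
Proof. by move=> x0; rewrite mulr_ge0 ?hypoexp_ge0. Qed.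

Lemma age_tail0 : age_tail 0 = 1.
Proof. by rewrite /age_tail !hypoexp0 mulr1. Qed.

Lemma age_tail_nonincreasing x y : 0 <= x -> x <= y ->
  age_tail y <= age_tail x.
Proof.
move=> x0 xy; have y0 := le_trans x0 xy.
by rewrite ler_pM ?hypoexp_ge0 ?hypoexp_nonincreasing.
Qed.

(** The mean value theorem and the monotonicity of the tail compare increments of the antiderivative
    with terms of Riemann sums, so that no integral of the tail is ever taken. *)
Lemma age_tail_integral_step x d : 0 <= x -> 0 <= d ->
  d * age_tail (x + d) <= age_tail_integral x - age_tail_integral (x + d) /\
  age_tail_integral x - age_tail_integral (x + d) <= d * age_tail x.
Proof.
move=> x0 d0.
have xd : x <= x + d by rewrite lerDl.
have [c /andP[xc cd] E] := is_derive_mean_value xd is_derive_age_tail_integral.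
have -> : age_tail_integral x - age_tail_integral (x + d) = d * age_tail c.
  by rewrite -opprB E mulNr opprK mulrC addrAC subrr add0r.
have c0 := le_trans x0 xc.
by split; rewrite ler_wpM2l// age_tail_nonincreasing.
Qed.

Lemma age_tail_integral_ge0 x : 0 <= x -> 0 <= age_tail_integral x.
Proof.
move=> x0; rewrite /age_tail_integral.
have ? := hypoexp_ge0 l1 m10 x0; have ? := hypoexp_ge0 l2 m20 x0.
have ? c : 0 <= expR (c * x) by exact: expR_ge0.
have [? ? ? ?] : [/\ 0 < m1 + m2, 0 < l1 + m2, 0 < l2 + m1 & 0 < l1 + l2].
  by split; exact: addr_gt0.
have a0 : 0 <= (m1 + m2)^-1 by rewrite invr_ge0 ltW.
have b0 : 0 <= (m1 + m2)^-1 * m1 / (l1 + m2).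
  by rewrite divr_ge0 ?mulr_ge0// ltW.
have c0 : 0 <= (m1 + m2)^-1 * m2 / (l2 + m1).
  by rewrite divr_ge0 ?mulr_ge0// ltW.
have e0 : 0 <= ((m1 + m2)^-1 * m1 / (l1 + m2) * m2 +
    (m1 + m2)^-1 * m2 / (l2 + m1) * m1) / (l1 + l2).
  by rewrite divr_ge0 ?addr_ge0 ?(mulr_ge0 b0) ?(mulr_ge0 c0)// ltW.
by do 3 ?apply: addr_ge0; apply: mulr_ge0 => //; exact: mulr_ge0.
Qed.

Lemma age_tail_decay : exists C c : R, [/\ 0 < C, 0 < c &
  forall x, 0 <= x -> age_tail x <= C * expR (- c * x) /\
                     age_tail_integral x <= C * expR (- c * x)].
Proof.
(* The decay is taken from the factors of index 1 alone. Halving makes [c] strictly smaller than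
   [m1], as the constant [m1 / (m1 - c)] requires. *)
pose c := Num.min l1 m1 / 2.
have min0 : 0 < Num.min l1 m1 by rewrite lt_min l10.
have c0 : 0 < c by rewrite divr_gt0.
have cmin : c < Num.min l1 m1 by rewrite /c ltr_pdivrMr// ltr_pMr// ltr1n.
have cl : c < l1 by rewrite (lt_le_trans cmin)// ge_min lexx.
have cm : c < m1 by rewrite (lt_le_trans cmin)// ge_min lexx orbT.
pose C1 := m1 / (m1 - c).
have C11 : 1 <= C1.
  by rewrite /C1 ler_pdivlMr ?subr_gt0// mul1r lerBlDr lerDl ltW.
pose K := age_tail_integral 0.
have K0 : 0 <= K by exact: age_tail_integral_ge0.
(* Each term of [age_tail_integral] has a factor of index 1, at most [C1 * expR (- c * x)], and one
   of index 2, at most 1; the coefficients add up to [K]. *)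
exists (C1 * (1 + K)), c; split=> [|//|x x0].
  by rewrite mulr_gt0 ?(lt_le_trans _ C11)// ltr_wpDr.
have h1 : hypoexp l1 m1 x <= C1 * expR (- c * x).
  by rewrite hypoexp_le_expR// ltW.
have h2 : hypoexp l2 m2 x <= 1.
  by rewrite -(hypoexp0 l2 m2) hypoexp_nonincreasing.
have h10 := hypoexp_ge0 l1 m10 x0; have h20 := hypoexp_ge0 l2 m20 x0.
have g1 : expR (- l1 * x) <= C1 * expR (- c * x).
  apply: (@le_trans _ _ (expR (- c * x))); last by rewrite ler_peMl.
  by rewrite ler_expR ler_wpM2r// lerN2 ltW.
have g2 : expR (- l2 * x) <= 1.
  by rewrite -expR0 ler_expR mulNr oppr_le0 mulr_ge0// ltW.
have C1e : 0 <= C1 * expR (- c * x) by exact: le_trans h1.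
split.
  rewrite mulrAC mulrDr mulr1 (@le_trans _ _ (C1 * expR (- c * x)))//.
    by rewrite -[leRHS]mulr1 ler_pM.
  by rewrite lerDl mulr_ge0.
rewrite mulrAC mulrDr mulr1 (@le_trans _ _ (C1 * expR (- c * x) * K))//; last first.
  by rewrite lerDr.
rewrite /K /age_tail_integral !hypoexp0 !mulr0 expR0 !mulr1.
have [? ? ? ?] : [/\ 0 < m1 + m2, 0 < l1 + m2, 0 < l2 + m1 & 0 < l1 + l2].
  by split; exact: addr_gt0.
have a0 : 0 <= (m1 + m2)^-1 by rewrite invr_ge0 ltW.
have b0 : 0 <= (m1 + m2)^-1 * m1 / (l1 + m2).
  by rewrite divr_ge0 ?mulr_ge0// ltW.
have d0 : 0 <= (m1 + m2)^-1 * m2 / (l2 + m1).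
  by rewrite divr_ge0 ?mulr_ge0// ltW.
set a := (m1 + m2)^-1 in a0 b0 d0 *.
set b := a * m1 / _ in b0 *; set d := a * m2 / _ in d0 *.
have f0 : 0 <= (b * m2 + d * m1) / (l1 + l2).
  by rewrite divr_ge0 ?addr_ge0 ?(mulr_ge0 b0) ?(mulr_ge0 d0)// ltW.
set f := _ / (l1 + l2) in f0 *.
set E := C1 * _ in h1 g1 C1e *.
have le_prod u v : 0 <= u -> 0 <= v -> u <= E -> v <= 1 -> u * v <= E.
  by move=> u0 v0 uE v1; rewrite -[leRHS]mulr1 ler_pM.
rewrite !mulrDr !(mulrC E) !lerD// ler_wpM2l// le_prod//.
Qed.

End mean_age.

End two_stage.

Lemma bounded_integrable d (T : measurableType d) (R : realType)
    (P : probability T R) (f : T -> R) (M : R) :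
  measurable_fun setT f -> (forall x, `|f x| <= M) ->
  P.-integrable setT (EFin \o f).
Proof.
move=> mf fM; apply: measurable_bounded_integrable => //.
  by rewrite (le_lt_trans (probability_le1 P _))// ltry.
exists M; split; first exact: num_real.
by move=> y My x _ /=; rewrite (le_trans (fM x))// ltW.
Qed.

Section exponential_integrals.
Context {R : realType} (Q : probability R R) (lam : R).
Hypotheses (lam0 : 0 < lam)
  (QE : forall B, measurable B -> Q B = exponential_prob lam B).
Local Notation mu := (@lebesgue_measure R).

(** Given the first stage [y], the integrand is the probability that the second one lasts beyond
    [x - y]. It is 1 for [y > x]; on [0, x] a multiple of [primexp (m - lam)] is an
    antiderivative. *)
Lemma integral_hypoexp (m x : R) : 0 < m -> 0 <= x ->
  (\int[Q]_y (expR (- m * Num.max 0 (x - y)))%:E = (hypoexp lam m x)%:E)%E.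
Proof.
move=> m0 x0.
pose g (y : R) := expR (- m * Num.max 0 (x - y)).
have mg : measurable_fun setT g.
  apply: measurableT_comp => //; apply: measurable_funM => //.
  by apply: measurable_maxr => //; exact: measurable_funB.
have g01 y : 0 <= g y <= 1.
  rewrite expR_ge0/= -expR0 ler_expR mulNr oppr_le0 mulr_ge0//; first exact: ltW.
  by rewrite le_max lexx.
rewrite (integral_exponential QE); last first.
  apply: (@bounded_integrable _ _ _ _ _ 1) => // y.
  by have /andP[? ?] := g01 y; rewrite ger0_norm.
pose p (y : R) := lam * expR (- lam * y).
have mp : measurable_fun setT p.
  by apply: measurable_funM => //; apply: measurableT_comp => //; exact: measurable_funM.
have p0 y : 0 <= p y by rewrite mulr_ge0 ?expR_ge0 ?ltW.
transitivity (\int[mu]_(y in `[0%R, +oo[) (g y * p y)%:E)%E.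
  rewrite [RHS]integral_mkcond; apply: eq_integral => y _.
  rewrite /exponential_pdf patchE /= [in RHS]patchE; case: ifPn => _ //.
  by rewrite mule0.
have -> : `[0%R, +oo[%classic = `[0%R, x]%classic `|` `]x, +oo[%classic :> set R.
  by rewrite -itv_bndbnd_setU ?bnd_simp.
have mgp (B : set R) : measurable_fun B (fun y => (g y * p y)%:E).
  by apply: measurable_fun_EFin; apply: measurable_funTS; exact: measurable_funM.
rewrite ge0_integral_setU//; last 3 first.
- exact: mgp.
- by move=> y _; rewrite lee_fin mulr_ge0//; case/andP : (g01 y).
- apply/disj_setPS => y [/=]; rewrite !in_itv/= andbT => /andP[_ yx].
  by rewrite ltNge yx.
have -> : (\int[mu]_(y in `]x, +oo[) (g y * p y)%:E = (expR (- lam * x))%:E)%E.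
  transitivity (Q `]x, +oo[%classic); last first.
    by rewrite (exponential_gt QE) max_r.
  rewrite QE// /exponential_prob; apply: eq_integral => y.
  rewrite inE/= in_itv/= andbT => xy.
  have y0 : 0 <= y by rewrite ltW// (le_lt_trans x0).
  rewrite exponential_pdfE// /g max_l; first by rewrite mulr0 expR0 mul1r.
  by rewrite subr_le0 ltW.
have -> : (\int[mu]_(y in `[0%R, x]) (g y * p y)%:E =
    (lam * (expR (- m * x) * primexp (m - lam) x))%:E)%E.
  move: x0; rewrite le_eqVlt => /orP[/eqP x0|x0].
    by rewrite -x0 primexp0 !mulr0 set_itv1 integral_set1.
  pose F (y : R) := lam * expR (- m * x) * primexp (m - lam) y.
  have dF (y : R) : is_derive y 1 F (0 * primexp (m - lam) y +
      lam * expR (- m * x) * expR ((m - lam) * y)).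
    by apply: is_derive_mulf; exact: is_derive_primexp.
  have cF : continuous F.
    by move=> y; apply: differentiable_continuous; apply/derivable1_diffP.
  pose f (y : R) := lam * expR (- m * x) * expR ((m - lam) * y).
  transitivity (\int[mu]_(y in `[0%R, x]) (f y)%:E)%E.
    apply: eq_integral => y; rewrite inE/= in_itv/= => /andP[y0 yx].
    rewrite /g /p /f max_r ?subr_ge0//; congr EFin.
    rewrite mulrCA -!mulrA -!expRD; congr (_ * expR _); ring.
  rewrite (@continuous_FTC2 _ f F)//.
  - by rewrite /F primexp0 mulr0 sube0 mulrA.
  - apply: continuous_subspaceT => y.
    by apply: differentiable_continuous; apply/derivable1_diffP.
  - split => //.
    + by apply: cvg_at_right_filter; exact: cF.
    + by apply: cvg_at_left_filter; exact: cF.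
  - by move=> y _; rewrite derive1E derive_val mul0r add0r.
by rewrite -hypoexpBexpR -EFinD subrK.
Qed.

End exponential_integrals.

(** * Deadlines and value functions *)

Section deadlines.
Context {R : realType}.
Implicit Types (beta phi v : R -> R) (a b s x y : R).

(* [beta s] is the time before which an update generated at [s] must not be delivered; a value
   smaller than [s] imposes nothing. *)
Definition meets_deadline beta s x y : R :=
  if (x < y) && (s + x <= beta s) then 0 else 1.

(** A violation is a service time below the preemption time [y] and within the remaining time
    [beta s - s]; a negative remaining time imposes nothing. *)
Definition meets_deadline_prob m beta s y : R :=
  expR (- m * Num.max 0 (Num.min y (beta s - s))).

Lemma meets_deadline_ge0 beta s x y : 0 <= meets_deadline beta s x y.
Proof. by rewrite /meets_deadline; case: ifP. Qed.

Lemma measurable_meets_deadline beta : measurable_fun setT beta ->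
  measurable_fun setT (fun z : R * R * R => meets_deadline beta z.1.1 z.1.2 z.2).
Proof.
move=> mb.
have m11 : measurable_fun setT (fun z : R * R * R => z.1.1).
  by apply: measurable_fun_fst; exact: measurable_fun_fst.
have m12 : measurable_fun setT (fun z : R * R * R => z.1.2).
  by apply: measurable_fun_snd; exact: measurable_fun_fst.
apply: measurable_fun_ifT => //.
apply: measurable_and; first exact: measurable_fun_ltr.
apply: measurable_fun_ler; first exact: measurable_funD.
exact: (measurableT_comp mb).
Qed.

Lemma measurable_meets_deadline_prob m beta : measurable_fun setT beta ->
  measurable_fun setT (fun z : R * R => meets_deadline_prob m beta z.1 z.2).
Proof.
move=> mb; apply: measurableT_comp => //; apply: measurable_funM => //.
apply: measurable_maxr => //; apply: measurable_minr => //.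
by apply: measurable_funB => //; exact: (measurableT_comp mb).
Qed.

Definition no_deadline s : R := s - 1.

Lemma meets_no_deadline_prob m beta s y : beta s = s - 1 ->
  meets_deadline_prob m beta s y = 1.
Proof.
move=> bs; rewrite /meets_deadline_prob bs max_l ?mulr0 ?expR0//.
by rewrite ge_min addrAC subrr add0r lerN10 orbT.
Qed.

(** Meeting these deadlines encodes staleness of ]a, b] together with what [beta] demands after [b],
    so that windows stack from the last to the first. *)
Definition window_deadline a b beta s : R :=
  if s <= a then s - 1 else if s <= b then b else beta s.

Lemma measurable_window_deadline a b beta : measurable_fun setT beta ->
  measurable_fun setT (window_deadline a b beta).
Proof.
move=> mb; apply: measurable_fun_ifT => //; first exact: measurable_fun_ler.
  exact: measurable_funB.
by apply: measurable_fun_ifT => //; exact: measurable_fun_ler.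
Qed.

Section laws.
Variables (QA QS : probability R R) (l m : R).
Hypotheses (l0 : 0 < l) (m0 : 0 < m)
  (QAE : forall B, measurable B -> QA B = exponential_prob l B)
  (QSE : forall B, measurable B -> QS B = exponential_prob m B).

Lemma integral_meets_deadline beta s y :
  (\int[QS]_x (meets_deadline beta s x y)%:E =
   (meets_deadline_prob m beta s y)%:E)%E.
Proof.
pose c := beta s - s.
(* The service times that violate the deadline: [x < y] and [x <= c], so the end is open exactly
   when [y <= c]. *)
pose B : set R := [set` Interval -oo%O (BSide (y <= c) (Num.min y c))].
have mB : measurable B by exact: measurable_itv.
rewrite (eq_integral (fun x => (\1_(~` B) x)%:E)); last first.
  move=> x _; rewrite indicE in_setC mem_setE /meets_deadline.
  rewrite -lerBrDl -/c (_ : _ && _ = (x \in Interval -oo%O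
    (BSide (y <= c) (Num.min y c)))); first by case: (x \in _).
  rewrite in_itv/=; case: (leP y c) => yc /=.
    by apply/andP/idP => [[]//|xy]; split => //; rewrite ltW// (lt_le_trans xy).
  by apply/andP/idP => [[]//|xc]; split => //; rewrite (le_lt_trans xc).
rewrite integral_indic//; last exact: measurableC.
rewrite setIT; transitivity (1 - QS B)%E; first exact: probability_setC.
rewrite (exponential_lt QSE).
by rewrite EFinB oppeB// addeA subee// add0e.
Qed.

Lemma ae_eq_exponential_integral (f g : R -> R) :
  measurable_fun setT f -> measurable_fun setT g ->
  (forall y, 0 < y -> f y = g y) ->
  (\int[QA]_y (f y)%:E = \int[QA]_y (g y)%:E)%E.
Proof.
move=> mf mg fg; apply: ae_eq_integral => //; try exact: measurable_fun_EFin.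
exists `]-oo, 0]%classic; split => //; first exact: (exponential_le0 QAE).
move=> y /=; rewrite in_itv/= leNgt => /not_implyP[_ nfg].
by apply/negP => /fg E; apply: nfg; rewrite E.
Qed.

(** Harmonicity for the renewal step. The solution of interest is the probability that the update
    generated at [s] and all later ones meet their deadlines. *)
Definition deadline_value beta v := forall s,
  (\int[QA]_y (meets_deadline_prob m beta s y * v (s + y))%:E = (v s)%:E)%E.

(** Nothing is at stake before [b]: an update generated there is worth what the first arrival after
    [b] is worth on average. *)
Definition stationary_before v b :=
  (forall s, s <= b -> v s = v b) /\
  (\int[QA]_y (v (b + y))%:E = (v b)%:E)%E.

(** Here [v (s + y)] depends on [y] through its excess over [b - s] only, and that excess, once
    positive, is again exponential. *)
Lemma stationary_before_integral (v : R -> R) b s : measurable_fun setT v ->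
  (forall s, 0 <= v s) -> stationary_before v b -> s <= b ->
  (\int[QA]_y (v (s + y))%:E = (v b)%:E)%E.
Proof.
move=> mv v0 [vb Ivb] sb.
have mvb : measurable_fun setT (fun y => v (b + y)).
  by apply: (measurableT_comp mv); exact: measurable_funD.
have c0 : 0 <= b - s by rewrite subr_ge0.
rewrite (eq_integral (fun y => (v (b + Num.max (y - (b - s)) 0))%:E)).
  rewrite (exponential_memoryless l0 QAE c0 mvb)// Ivb addr0 -EFinM -EFinD.
  by congr EFin; ring.
move=> y _; congr EFin; case: (leP (y - (b - s)) 0) => [ybs|_].
  by rewrite addr0 vb//; move: ybs; rewrite subr_le0 lerBrDl.
by congr v; ring.
Qed.

(** In ]a, b] the interarrival law does not appear: the server stays busy until it delivers, and
    preemption merely restarts a memoryless service. Before [a] an arrival has to be awaited first,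
    which adds the stage of rate [l]. The factor [phi b] accounts for what follows [b]. *)
Definition window_value a b phi s : R :=
  if s <= a then phi b * hypoexp l m (b - a)
  else if s <= b then phi b * expR (- m * (b - s)) else phi s.

Section window.
Variables (a b : R) (phi : R -> R).
Hypotheses (ab : a <= b) (mphi : measurable_fun setT phi)
  (phi0 : forall s, 0 <= phi s) (phib : stationary_before phi b).

Let v := window_value a b phi.

Lemma measurable_window_value : measurable_fun setT v.
Proof.
apply: measurable_fun_ifT => //; first exact: measurable_fun_ler.
apply: measurable_fun_ifT => //; first exact: measurable_fun_ler.
apply: measurable_funM => //; apply: measurableT_comp => //.
by apply: measurable_funM => //; exact: measurable_funB.
Qed.

Lemma window_value_ge0 s : 0 <= v s.
Proof.
rewrite /v /window_value; case: ifP => _.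
  by rewrite mulr_ge0// hypoexp_ge0// subr_ge0.
by case: ifP => _ //; rewrite mulr_ge0// expR_ge0.
Qed.

Lemma window_value_left s : s <= a -> v s = phi b * hypoexp l m (b - a).
Proof. by rewrite /v /window_value => ->. Qed.

Lemma window_value_stationary : stationary_before v a.
Proof.
split=> [s sa|]; first by rewrite !window_value_left.
have mshift (w : R -> R) c : measurable_fun setT w ->
    measurable_fun setT (fun y : R => w (c + y) : R).
  by move=> mw; apply: (measurableT_comp mw); exact: measurable_funD.
have mv := mshift _ a measurable_window_value.
pose psi y := expR (- m * Num.max 0 (b - a - y)).
have mpsi : measurable_fun setT psi.
  apply: measurableT_comp => //; apply: measurable_funM => //.
  by apply: measurable_maxr => //; exact: measurable_funB.
have psi0 y : 0 <= psi y by exact: expR_ge0.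
(* The integrands agree whether [a + y] is below or above [b]; adding [phi b] avoids cutting the
   integral there. *)
have E : (\int[QA]_y (v (a + y) + phi b)%:E =
    \int[QA]_y (phi b * psi y + phi (a + y))%:E)%E.
  apply: ae_eq_exponential_integral => [||y y0].
  - exact: measurable_funD.
  - apply: measurable_funD; last exact: mshift.
    exact: measurable_funM.
  rewrite /v /window_value /psi leNgt ltrDl y0/=; case: leP => ayb.
    rewrite (phib.1 _ ayb) max_r; last by rewrite -addrA -opprD subr_ge0.
    by rewrite opprD addrA.
  rewrite max_l; last by rewrite -addrA -opprD subr_le0 ltW.
  by rewrite mulr0 expR0 mulr1 addrC.
move: E; under eq_integral do rewrite EFinD.
under [in RHS]eq_integral do rewrite EFinD.
have cstE (c : R) : (\int[QA]_y c%:E = c%:E)%E.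
  by rewrite integral_cst//= -[RHS]mule1; congr (_ * _)%E; exact: probability_setT.
have psiE : (\int[QA]_y (phi b * psi y)%:E = (phi b * hypoexp l m (b - a))%:E)%E.
  under eq_integral do rewrite EFinM.
  rewrite ge0_integralZl//; first by rewrite (integral_hypoexp l0 QAE)// subr_ge0.
  - exact: measurable_fun_EFin.
  - by move=> y _; rewrite lee_fin.
  - by rewrite lee_fin.
rewrite !ge0_integralD//; try exact: measurable_fun_EFin;
  try by move=> y _; rewrite lee_fin ?window_value_ge0 ?mulr_ge0.
- rewrite cstE psiE (stationary_before_integral _ _ phib)//.
  by move/(congr1 (fun z => z - (phi b)%:E)%E); rewrite !addeK// window_value_left.
- by apply: measurable_fun_EFin; exact: measurable_funM.
- by apply: measurable_fun_EFin; exact: mshift.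
Qed.

Lemma window_deadline_value beta : deadline_value beta phi ->
  measurable_fun setT beta ->
  deadline_value (window_deadline a b beta) v.
Proof.
move=> fix_phi mb s.
have mshift (w : R -> R) c : measurable_fun setT w ->
    measurable_fun setT (fun y : R => w (c + y) : R).
  by move=> mw; apply: (measurableT_comp mw); exact: measurable_funD.
have mprob (be : R -> R) : measurable_fun setT be ->
    measurable_fun setT (fun y => meets_deadline_prob m be s y).
  move=> mbe; apply: (measurableT_comp
    (f := fun z : R * R => meets_deadline_prob m be z.1 z.2)
    (g := fun y : R => (s, y))).
  - exact: measurable_meets_deadline_prob.
  - exact: pair1_measurable.
have [sa|sa] := leP s a.
  rewrite window_value_left// -(window_value_left (lexx a)).
  rewrite -(stationary_before_integral measurable_window_value
    window_value_ge0 window_value_stationary sa).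
  apply: eq_integral => y _.
  by rewrite meets_no_deadline_prob ?mul1r// /window_deadline sa.
have sa' : (s <= a) = false by rewrite leNgt sa.
have mv := mshift _ s measurable_window_value.
have mprod : measurable_fun setT (fun y =>
    meets_deadline_prob m (window_deadline a b beta) s y * v (s + y)).
  by apply: measurable_funM => //; apply: mprob; exact: measurable_window_deadline.
have vs y : 0 < y -> v (s + y) =
    if s + y <= b then phi b * expR (- m * (b - (s + y))) else phi (s + y).
  move=> y0; rewrite /v /window_value ifF//; apply/negbTE.
  by rewrite -ltNge (lt_trans sa)// ltrDl.
have [sb|sb] := leP s b; last first.
  rewrite [in RHS]/v /window_value sa' leNgt sb/= -fix_phi.
  apply: ae_eq_exponential_integral => // [|y y0].
    by apply: measurable_funM; [exact: mprob|exact: mshift].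
  rewrite vs// leNgt (lt_trans sb) ?ltrDl//=.
  by rewrite /meets_deadline_prob /window_deadline sa' leNgt sb.
rewrite [in RHS]/v /window_value sa' sb.
(* If the next arrival comes by [b], lasting until it and then until [b] multiply to the survival of
   a single service; otherwise the current service alone has to last until [b]. The factor is the
   same. *)
transitivity (\int[QA]_y (expR (- m * (b - s)) * phi (s + y))%:E)%E.
  apply: ae_eq_exponential_integral => // [|y y0].
    by apply: measurable_funM => //; exact: mshift.
  rewrite vs// /meets_deadline_prob /window_deadline sa' sb.
  case: (leP (s + y) b) => syb.
    rewrite min_l; last by rewrite lerBrDl.
    rewrite max_r; last exact: ltW.
    rewrite (phib.1 _ syb) mulrCA -expRD mulrC; congr (expR _ * _); ring.
  rewrite min_r; last by rewrite lerBlDl ltW.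
  by rewrite max_r// subr_ge0.
under eq_integral do rewrite EFinM.
rewrite ge0_integralZl//.
- by rewrite (stationary_before_integral _ _ phib)// -EFinM mulrC.
- by apply: measurable_fun_EFin; exact: mshift.
- by move=> y _; rewrite lee_fin.
Qed.

End window.

Lemma no_deadline_value : deadline_value no_deadline (cst 1).
Proof.
move=> s; rewrite (eq_integral (cst 1%E)); last first.
  by move=> y _; rewrite meets_no_deadline_prob// mulr1.
by rewrite integral_cst//= mul1e; exact: probability_setT.
Qed.

Lemma cst_stationary_before c b : stationary_before (cst c) b.
Proof.
split => //; rewrite (eq_integral (cst c%:E))// integral_cst//.
by rewrite -[RHS]mule1; congr (_ * _)%E; exact: probability_setT.
Qed.

End laws.
End deadlines.

Lemma ae_foralln d (T : measurableType d) (R : realType)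
    (P : {measure set T -> \bar R}) (F : nat -> T -> Prop) :
  (forall n, {ae P, forall w, F n w}) -> {ae P, forall w, forall n, F n w}.
Proof.
move=> aeF; apply: (@negligibleS _ _ _ P (\bigcup_n ~` [set w | F n w])).
  by move=> w /= /existsNP[n nF]; exists n.
by apply: negligible_bigcup => n; exact: aeF.
Qed.

(** * The probability that all deadlines are met *)

Section deadlines_met.
Context d (T : measurableType d) (R : realType) (P : probability T R)
  (I : eqType) (X : I -> {mfun T >-> R}) (iA iS : nat -> I)
  (QA QS : probability R R) (l m : R).
Hypotheses (indep : mutually_independent P (fun i => X i : T -> R))
  (iA_inj : injective iA) (iS_inj : injective iS)
  (iAS : forall k i, iA k <> iS i)
  (l0 : 0 < l) (m0 : 0 < m)
  (lawA : forall k B, measurable B -> P (X (iA k) @^-1` B) = QA B)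
  (lawS : forall k B, measurable B -> P (X (iS k) @^-1` B) = QS B)
  (QAE : forall B, measurable B -> QA B = exponential_prob l B)
  (QSE : forall B, measurable B -> QS B = exponential_prob m B).

Let A k : T -> R := X (iA k).
Let S k : T -> R := X (iS k).

Lemma ae_interarrival_gt0 : {ae P, forall w, forall k, 0 < A k w}.
Proof.
apply: ae_foralln => k; exists (X (iA k) @^-1` `]-oo, 0]%classic); split.
- by rewrite -[_ @^-1` _]setTI; exact: measurable_funP.
- by rewrite -(exponential_le0 QAE); exact: lawA.
- by move=> w /= /negP; rewrite -leNgt in_itv.
Qed.

Let r : R := fine (\int[QA]_y (expR (- y))%:E).

Let int_expN : (\int[QA]_y (expR (- y))%:E = r%:E)%E /\ r < 1.
Proof.
have mexp : measurable_fun setT (fun y : R => expR (- y)).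
  by apply: measurableT_comp.
pose B : set R := `]1, +oo[%classic.
have mB : measurable B by exact: measurable_itv.
(* Beyond 1, [expR (- y)] falls short of 1 by at least [c], and [B] has positive probability: this
   forces [r < 1]. *)
pose c := 1 - expR (- 1 : R).
have c0 : 0 < c by rewrite subr_gt0 -expR0 ltr_expR oppr_lt0.
have QB : QA B = (expR (- l))%:E by rewrite (exponential_gt QAE) max_r// mulr1.
pose f (y : R) := expR (- Num.max 0 y).
have mf : measurable_fun setT f.
  apply: measurableT_comp => //; apply: measurableT_comp => //.
  exact: measurable_maxr.
have fE : (\int[QA]_y (expR (- y))%:E = \int[QA]_y (f y)%:E)%E.
  by apply: (ae_eq_exponential_integral QAE) => // y y0; rewrite /f max_r// ltW.
have mcB : measurable_fun setT (fun y => c * \1_B y).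
  by apply: measurable_funM => //; exact: measurable_indic.
have le1 : (\int[QA]_y (f y)%:E + (c * expR (- l))%:E <= 1)%E.
  have -> : (c * expR (- l))%:E = (\int[QA]_y (c * \1_B y)%:E)%E.
    under eq_integral do rewrite EFinM.
    rewrite ge0_integralZl//.
    - by rewrite integral_indic// setIT EFinM; congr (_ * _)%E.
    - by apply: measurable_fun_EFin; exact: measurable_indic.
    - by rewrite lee_fin ltW.
  rewrite -ge0_integralD//; last 4 first.
  - by move=> y _; rewrite lee_fin expR_ge0.
  - exact: measurable_fun_EFin.
  - by move=> y _; rewrite lee_fin mulr_ge0// ltW.
  - exact: measurable_fun_EFin.
  apply: (@le_trans _ _ (\int[QA]_y (cst 1 y))%E); last first.
    by rewrite integral_cst// mul1e; exact: probability_le1.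
  apply: ge0_le_integral => //.
  - by move=> y _; rewrite -EFinD lee_fin addr_ge0 ?expR_ge0// mulr_ge0// ltW.
  - by apply: emeasurable_funD; exact: measurable_fun_EFin.
  move=> y _; rewrite -EFinD lee_fin /f indicE mem_setE in_itv/= andbT.
  case: ltP => y1.
    rewrite mulr1 max_r ?(le_trans ler01 (ltW y1))// /c addrCA gerDl subr_le0.
    by rewrite ler_expR lerN2 ltW.
  by rewrite mulr0 addr0 -expR0 ler_expR oppr_le0 le_max lexx.
have ge0 : (0 <= \int[QA]_y (expR (- y))%:E)%E.
  by apply: integral_ge0 => y _; rewrite lee_fin expR_ge0.
have cl0 : 0 < c * expR (- l) by rewrite mulr_gt0 ?expR_gt0.
have fin : (\int[QA]_y (expR (- y))%:E)%E \is a fin_num.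
  rewrite ge0_fin_numE// fE (le_lt_trans _ (ltry 1))// (le_trans _ le1)//.
  by rewrite leeDl// lee_fin ltW.
split; first by rewrite /r fineK.
move: le1; rewrite -fE -(fineK fin) -/r -EFinD lee_fin => le1.
by rewrite (lt_le_trans _ le1)// ltrDl.
Qed.

(** Chernoff bound: if all generation times stay below [B], then [expR (- arrival A k w)] is at
    least [expR (- B)] for all [k], whereas its mean [r ^+ k.+1] tends to 0. *)
Lemma ae_arrival_unbounded (B : R) :
  {ae P, forall w, exists k, B < arrival A k w}.
Proof.
have [rE r1] := int_expN.
have r0 : 0 <= r by rewrite fine_ge0// integral_ge0// => y _; rewrite lee_fin expR_ge0.
have mar k : measurable_fun setT (arrival A k).
  by apply: measurable_arrival => i _.
have E k : (\int[P]_w (expR (- arrival A k w))%:E = (r ^+ k.+1)%:E)%E.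
  have := @integral_weight _ _ _ P _ X iA iS QA QS indep iA_inj iS_inj iAS
    lawA lawS (fun _ _ => 1) (fun _ _ _ => 1) (fun y => expR (- y)) r.
  move=> /(_ _ _ _ _ _ _ r0 _ _ k) H.
  rewrite exprSr [in RHS]EFinM -[X in (_ * X)%E]rE -H//.
  - apply: eq_integral => w _; rewrite /weight big1 ?mul1r//.
  - by apply: measurableT_comp.
  - by move=> s y; rewrite integral_cst//= mul1e; exact: probability_setT.
  - move=> s; rewrite EFinM -rE -ge0_integralZr//.
    + by apply: eq_integral => y _; rewrite mul1r opprD expRD mulrC EFinM.
    + by apply: measurable_fun_EFin; apply: measurableT_comp.
pose N := \bigcap_k (arrival A k @^-1` `]-oo, B]%classic).
have mN : measurable N.
  apply: bigcap_measurable => // k _; rewrite -[_ @^-1` _]setTI.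
  exact: mar.
exists N; split => //; last first.
  move=> w /= /forallNP nB k _ /=; rewrite in_itv/= leNgt; exact/negP/nB.
have PN : P N = (fine (P N))%:E by rewrite fineK// fin_num_measure.
have le k : fine (P N) * expR (- B) <= r ^+ k.+1.
  rewrite -lee_fin EFinM -PN -E muleC -integral_cst//.
  rewrite integral_mkcond; apply: ge0_le_integral => //.
  - by move=> w _; rewrite patchE; case: ifP => // _; rewrite lee_fin expR_ge0.
  - apply/(measurable_restrictT _ mN) => //.
  - by apply: measurable_fun_EFin; do 2 apply: measurableT_comp => //.
  - move=> w _; rewrite patchE; case: ifPn => [|_]; last by rewrite lee_fin expR_ge0.
    rewrite inE => /(_ k Logic.I) /=; rewrite in_itv/= => wB.
    by rewrite lee_fin ler_expR lerN2.
rewrite PN; congr EFin; apply/eqP; rewrite eq_le fine_ge0// andbT.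
rewrite -(pmulr_lle0 _ (expR_gt0 (- B))).
have cv : (GRing.exp r : R^nat) @ \oo --> (0 : R).
  by apply: cvg_expr; rewrite ger0_norm.
apply: (cvgr_to_ge cv); exists 1%N => // -[//|k] _; exact: le.
Qed.

Variables (beta v : R -> R) (B : R).
Hypotheses (mbeta : measurable_fun setT beta) (mv : measurable_fun setT v)
  (v01 : forall s, 0 <= v s <= 1) (vB : forall s, B < s -> v s = 1)
  (fixv : deadline_value QA m beta v).

Definition deadlines_met : set T := [set w | forall k,
  ~ (S k w < A k.+1 w /\ arrival A k w + S k w <= beta (arrival A k w))].

Let deadline_weight k w :=
  meets_deadline beta (arrival A k w) (S k w) (A k.+1 w).

Let deadlines_metE :
  deadlines_met = \bigcap_k (deadline_weight k @^-1` [set 1]).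
Proof.
apply/seteqP; split => w H k.
  move=> _ /=; rewrite /deadline_weight /meets_deadline; case: ifPn => // /andP[].
  by move=> h1 h2; have := H k; case.
move=> [h1 h2]; have := H k Logic.I.
rewrite /= /deadline_weight /meets_deadline h1 h2/= => /esym/eqP.
by rewrite oner_eq0.
Qed.

(** The source [T'] is left free so that it can be [T] with the sigma-algebra generated by the
    variables of one server. *)
Lemma measurable_deadlines_met d' (T' : measurableType d') (f : T' -> T) :
  (forall k, measurable_fun setT (A k \o f)) ->
  (forall k, measurable_fun setT (S k \o f)) ->
  measurable (f @^-1` deadlines_met).
Proof.
move=> mA mS; rewrite deadlines_metE preimage_bigcap.
apply: bigcap_measurable => // k _.
rewrite -[X in measurable X]setTI.
have -> : f @^-1` (deadline_weight k @^-1` [set 1]) =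
  (fun w => meets_deadline beta (arrival (fun i => A i \o f) k w)
     ((S k \o f) w) ((A k.+1 \o f) w)) @^-1` [set 1] by [].
have mk : measurable_fun setT (fun w =>
    meets_deadline beta (arrival (fun i => A i \o f) k w)
     ((S k \o f) w) ((A k.+1 \o f) w)).
  apply: (measurableT_comp
    (f := fun z : R * R * R => meets_deadline beta z.1.1 z.1.2 z.2)
    (g := fun w => (arrival (fun i => A i \o f) k w, (S k \o f) w,
                    (A k.+1 \o f) w))).
    exact: measurable_meets_deadline.
  apply: measurable_fun_pair => //; apply: measurable_fun_pair => //.
  exact: measurable_arrival.
exact: mk.
Qed.

(** The mean of [f_ n] does not depend on [n]. Almost surely [f_ n] is eventually equal to the
    indicator: a violation makes the product vanish from then on, and otherwise [v] is 1 once the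
    generation times exceed [B]. *)
Lemma probability_deadlines_met :
  P deadlines_met = (\int[QA]_y (v y)%:E)%E.
Proof.
have mW : measurable deadlines_met.
  by apply: (measurable_deadlines_met (f := idfun)) => k.
pose f_ n w := weight (meets_deadline beta) A S n w * v (arrival A n w).
have mf_ n : measurable_fun setT (f_ n).
  apply: measurable_funM.
    apply: measurable_weight => //; exact: measurable_meets_deadline.
  by apply: (measurableT_comp mv); exact: measurable_arrival.
have weight01 n w : 0 <= weight (meets_deadline beta) A S n w <= 1.
  rewrite /weight; apply/andP; split.
    by apply: prodr_ge0 => i _; exact: meets_deadline_ge0.
  apply: prodr_ile1 => i _; rewrite meets_deadline_ge0/=.
  by rewrite /meets_deadline; case: ifP.
have If n : (\int[P]_w (f_ n w)%:E = \int[QA]_y (v y)%:E)%E.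
  have v0 s : 0 <= v s by have /andP[] := v01 s.
  have fixv1 s : (\int[QA]_y (meets_deadline_prob m beta s y * v (s + y))%:E
      = (1 * v s)%:E)%E by rewrite mul1r fixv.
  have -> := integral_weight indep iA_inj iS_inj iAS lawA lawS
    (measurable_meets_deadline mbeta) (measurable_meets_deadline_prob m mbeta)
    mv (meets_deadline_ge0 beta) (fun s y => expR_ge0 _) v0 ler01
    (integral_meets_deadline QSE beta) fixv1 n.
  by rewrite expr1n mul1e.
have lim_f : {ae P, forall w, setT w ->
    (fun n => (f_ n w)%:E) @ \oo --> (\1_deadlines_met w)%:E}.
  have ae1 := ae_interarrival_gt0; have ae2 := ae_arrival_unbounded B.
  apply: filterS2 ae1 ae2 => w A0 [K BK] _.
  have [wW|/existsNP[k /contrapT [Sk Bk]]] := pselect (deadlines_met w).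
    rewrite indicE mem_set//; apply: cvg_near_cst; exists K => // n /= Kn.
    rewrite /f_ /weight big1 => [|i _]; last first.
      rewrite /meets_deadline; case: ifPn => // /andP[h1 h2].
      by have := wW i; case.
    rewrite mul1r vB// (lt_le_trans BK)// /arrival.
    rewrite -(subnKC Kn) -addSn big_split_ord/= lerDl sumr_ge0// => i _.
    exact/ltW/A0.
  rewrite indicE memNset//; last by move=> /(_ k); apply.
  apply: cvg_near_cst; exists k.+1 => // n /= kn.
  rewrite /f_ /weight (bigD1 (Ordinal kn))//= /meets_deadline.
  by rewrite Sk Bk !mul0r.
have int1 : P.-integrable setT (cst 1%:E).
  by apply: (@bounded_integrable _ _ _ P (cst 1) 1) => // x; rewrite normr1.
have dom : {ae P, forall w n, setT w -> (`|(f_ n w)%:E| <= cst 1%:E w)%E}.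
  apply: aeW => w n _; rewrite /f_ lee_fin.
  have /andP[w0 w1] := weight01 n w.
  have /andP[u0 u1] := v01 (arrival A n w).
  by rewrite ger0_norm ?mulr_ge0// mulr_ile1.
have mI : measurable_fun setT (fun w => \1_deadlines_met w : R).
  exact: measurable_indic.
have [_ _] := dominated_convergence measurableT
  (fun n => measurable_fun_EFin (mf_ n))
  (measurable_fun_EFin mI) lim_f int1 dom.
rewrite integral_indic// setIT => cv.
have -> : P deadlines_met = limn (fun n => \int[P]_w (f_ n w)%:E)%E.
  by apply/esym/cvg_lim.
apply/cvg_lim => //; under eq_fun do rewrite If.
exact: cvg_cst.
Qed.

End deadlines_met.

(** * Two disjoint windows *)

Section two_windows.
Context {R : realType}.
Implicit Types (a b l m : R).

Definition two_window_deadline a b a' b' : R -> R :=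
  window_deadline a b (window_deadline a' b' no_deadline).

Definition two_window_value l m a b a' b' : R -> R :=
  window_value l m a b (window_value l m a' b' (cst 1)).

Lemma measurable_two_window_deadline a b a' b' :
  measurable_fun setT (two_window_deadline a b a' b').
Proof. by do 2 apply: measurable_window_deadline; exact: measurable_funB. Qed.

Lemma window_value_le1 l m a b phi : 0 < l -> 0 < m -> a <= b ->
  (forall s, 0 <= phi s <= 1) -> forall s, window_value l m a b phi s <= 1.
Proof.
move=> l0 m0 ab phi01 s; have /andP[p0 p1] := phi01 b.
rewrite /window_value; case: ifP => _.
  rewrite mulr_ile1// ?hypoexp_ge0 ?subr_ge0// -(hypoexp0 l m).
  by rewrite hypoexp_nonincreasing ?subr_ge0.
case: ifP => [sb|_]; last by have /andP[] := phi01 s.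
by rewrite mulr_ile1 ?expR_ge0// -expR0 ler_expR mulNr oppr_le0 mulr_ge0 ?subr_ge0 ?(ltW m0).
Qed.

End two_windows.

Section one_server.
Context d (T : measurableType d) (R : realType) (P : probability T R)
  (I : eqType) (X : I -> {mfun T >-> R}) (iA iS : nat -> I)
  (l m : R).
Hypotheses (indep : mutually_independent P (fun i => X i : T -> R))
  (iA_inj : injective iA) (iS_inj : injective iS)
  (iAS : forall k i, iA k <> iS i)
  (l0 : 0 < l) (m0 : 0 < m)
  (lawA : forall k, is_exponential P (X (iA k)) l)
  (lawS : forall k, is_exponential P (X (iS k)) m).

Lemma probability_two_window_deadlines a b a' b' :
  0 <= a -> a <= b -> b <= a' -> a' <= b' ->
  P (deadlines_met X iA iS (two_window_deadline a b a' b')) =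
  (hypoexp l m (b - a) * hypoexp l m (b' - a'))%:E.
Proof.
move=> a0 ab ba' ab'.
pose QA : probability R R := distribution P (X (iA 0%N)).
pose QS : probability R R := distribution P (X (iS 0%N)).
have lawA' k B : measurable B -> P (X (iA k) @^-1` B) = QA B.
  by move=> mB; rewrite lawA//; apply/esym; exact: lawA.
have lawS' k B : measurable B -> P (X (iS k) @^-1` B) = QS B.
  by move=> mB; rewrite lawS//; apply/esym; exact: lawS.
have QAE B : measurable B -> QA B = exponential_prob l B by exact: lawA.
have QSE B : measurable B -> QS B = exponential_prob m B by exact: lawS.
have le1b : forall s : R, 0 <= (cst 1 s : R) <= 1 by move=> s; rewrite ler01 lexx.
pose v1 := window_value l m a' b' (cst 1).
have m1 : measurable_fun setT v1 by exact: measurable_window_value.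
have v10 s : 0 <= v1 s by exact: window_value_ge0.
have v11 s : 0 <= v1 s <= 1 by rewrite v10 window_value_le1.
have c1 := @cst_stationary_before R QA 1 b' : stationary_before QA (cst 1) b'.
have st1a' : stationary_before QA v1 a' by exact: (window_value_stationary l0 m0 QAE).
have st1 : stationary_before QA v1 b.
  split.
    by move=> s sb; rewrite /v1 !window_value_left// (le_trans sb).
  rewrite (stationary_before_integral l0 QAE m1 v10 st1a' ba').
  by rewrite /v1 !window_value_left.
have st2 : stationary_before QA (two_window_value l m a b a' b') a.
  exact: (window_value_stationary l0 m0 QAE).
rewrite (@probability_deadlines_met _ _ _ P _ X iA iS QA QS l m indep iA_inj iS_inj
  iAS lawA' lawS' QAE QSE _ (two_window_value l m a b a' b') b'); last first.
- apply: (window_deadline_value l0 m0 QAE) => //.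
    apply: (window_deadline_value l0 m0 QAE) => //; first exact: no_deadline_value.
    exact: measurable_funB.
  by apply: measurable_window_deadline; exact: measurable_funB.
- move=> s bs; rewrite /two_window_value /window_value.
  have h x : x <= b' -> (s <= x) = false.
    by move=> xb; apply/negbTE; rewrite -ltNge (le_lt_trans xb).
  have bb' := le_trans ba' ab'; have ab'' := le_trans ab bb'.
  by rewrite !h.
- by move=> s; rewrite window_value_le1// andbT window_value_ge0.
- exact: measurable_window_value.
- exact: measurable_two_window_deadline.
(* The first interarrival time is counted from time 0, which acts like an unconstrained update
   generated before [a]; hence [0 <= a]. *)
have /= := stationary_before_integral l0 QAE (measurable_window_value l m a b m1)
  (window_value_ge0 l m0 ab v10) st2 a0.
under eq_integral do rewrite add0r.
move=> ->; rewrite /two_window_value window_value_left//= /v1.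
by rewrite window_value_left//= mul1r mulrC.
Qed.

Definition stale (A S : nat -> T -> R) (a b : R) : set T := [set w | forall k,
  ~ [/\ S k w < A k.+1 w, a < arrival A k w & arrival A k w + S k w <= b]].

(* An update generated in ]a, b] cannot be delivered by [b'] >= [b] without being considered by
   the second window, since service times are positive. *)
Lemma stale_two_windows (A S : nat -> T -> R) a b a' b' w :
  a <= b -> b <= a' -> a' <= b' -> (forall k, 0 < S k w) ->
  (forall k, ~ (S k w < A k.+1 w /\
     arrival A k w + S k w <= two_window_deadline a b a' b' (arrival A k w)))
  <-> (stale A S a b `&` stale A S a' b') w.
Proof.
move=> ab ba' ab' S0.
have noS s k : s + S k w <= s - 1 -> False.
  by rewrite lerD2l => /(lt_le_trans (S0 k)); rewrite ltr0N1.
have leS s k c : s + S k w <= c -> s <= c.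
  by move=> h; rewrite (le_trans _ h)// lerDl ltW.
have dl s : two_window_deadline a b a' b' s =
    if s <= a then s - 1 else if s <= b then b
    else if s <= a' then s - 1 else if s <= b' then b' else s - 1 by [].
split=> [H|[H1 H2] k [SA]].
  have ltF (x y : R) : x < y -> (y <= x) = false by move=> xy; rewrite leNgt xy.
  split=> k [SA]; set s := arrival A k w => as_ sb; apply: (H k); split=> //;
      rewrite -/s dl.
    by rewrite (ltF _ _ as_) (leS _ _ _ sb).
  have bs := le_lt_trans ba' as_.
  by rewrite (ltF _ _ (le_lt_trans ab bs)) (ltF _ _ bs) (ltF _ _ as_) (leS _ _ _ sb).
set s := arrival A k w; rewrite dl.
case: (leP s a) => [_|as_]; first exact: noS.
case: (leP s b) => [_|bs] sd; first by apply: (H1 k).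
move: sd; case: (leP s a') => [_|a's]; first exact: noS.
case: (leP s b') => [_|_]; last exact: noS.
by move=> sd; apply: (H2 k).
Qed.

End one_server.

(** * The two-server network *)

Lemma ae_eq_measure d (T : measurableType d) (R : realType)
    (P : {measure set T -> \bar R}) (E F : set T) :
  measurable E -> measurable F -> {ae P, forall w, E w <-> F w} -> P E = P F.
Proof.
move=> mE mF EF; rewrite -(setIT E) -(setIT F) -!integral_indic//.
apply: ae_eq_integral => //; try exact/measurable_EFinP/measurable_indic.
apply: filterS EF => w EF _; congr EFin; rewrite !indicE; congr (nat_of_bool _)%:R.
by apply/idP/idP; rewrite !inE => /EF.
Qed.

Lemma measurable_stale d (T : measurableType d) (R : realType)
    (A S : nat -> T -> R) a b :
  (forall k, measurable_fun setT (A k)) ->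
  (forall k, measurable_fun setT (S k)) -> measurable (stale A S a b).
Proof.
move=> mA mS.
pose f k w := (S k w < A k.+1 w) &&
  ((a < arrival A k w) && (arrival A k w + S k w <= b)).
have -> : stale A S a b = \bigcap_k (f k @^-1` [set false]).
  apply/seteqP; split => w H k; rewrite /f.
    by move=> _ /=; apply/negbTE/and3P; exact: H.
  by move=> h; have := H k Logic.I; rewrite /= /f (introT and3P h).
apply: bigcap_measurable => // k _; rewrite -[_ @^-1` _]setTI.
have mar : measurable_fun setT (arrival A k) by exact: measurable_arrival.
have mf : measurable_fun setT (f k).
  apply: measurable_and; first exact: measurable_fun_ltr.
  apply: measurable_and; first exact: measurable_fun_ltr.
  by apply: measurable_fun_ler => //; exact: measurable_funD.
exact: mf.
Qed.

Section network.
Context d (T : measurableType d) (R : realType) (P : probability T R)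
  (lam mu : 'I_2 -> R) (A S : 'I_2 -> nat -> {RV P >-> R}).
Hypotheses (lam0 : forall j, 0 < lam j) (mu0 : forall j, 0 < mu j)
  (lawA : forall j k, is_exponential P (A j k) (lam j))
  (lawS : forall j k, is_exponential P (S j k) (mu j))
  (indep : mutually_independent P
    (fun x : ('I_2 * nat) + ('I_2 * nat) =>
       match x with
       | inl (j, k) => (A j k : T -> R)
       | inr (j, k) => (S j k : T -> R)
       end)).

Let X (x : ('I_2 * nat) + ('I_2 * nat)) : {mfun T >-> R} :=
  match x with inl p => A p.1 p.2 | inr p => S p.1 p.2 end.

Let indepX : mutually_independent P (fun x => X x : T -> R).
Proof.
rewrite [X in mutually_independent P X](_ : _ = fun x =>
  match x with inl (j, k) => (A j k : T -> R) | inr (j, k) => S j k end) //.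
by apply/funext => -[[j k]|[j k]].
Qed.

Let iA (j : 'I_2) k : ('I_2 * nat) + ('I_2 * nat) := inl (j, k).
Let iS (j : 'I_2) k : ('I_2 * nat) + ('I_2 * nat) := inr (j, k).

Lemma ae_positive : {ae P, forall w,
  (forall j k, 0 < A j k w) /\ (forall j k, 0 < S j k w)}.
Proof.
have pos (Y : 'I_2 -> nat -> {RV P >-> R}) r :
    (forall j k, is_exponential P (Y j k) (r j)) ->
    {ae P, forall w, forall j k, 0 < Y j k w}.
  move=> lawY.
  have aeY j : {ae P, forall w k, 0 < Y j k w}.
    apply: ae_foralln => k; exists (Y j k @^-1` `]-oo, 0]%classic); split.
    - by rewrite -[_ @^-1` _]setTI; exact: measurable_funP.
    - pose Q : probability R R := distribution P (Y j k).
      exact: (@exponential_le0 _ Q (r j) (lawY j k)).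
    - by move=> w /= /negP; rewrite -leNgt in_itv.
  apply: filterS2 (aeY ord0) (aeY (lift ord0 ord0)) => w H0 H1 j.
  by case: (unliftP ord0 j) => [j' ->|->//]; rewrite (ord1 j').
exact: filterS2 (pos _ _ lawA) (pos _ _ lawS).
Qed.

Definition network_stale (a b : R) : set T :=
  [set w | forall j, stale (fun k => A j k : T -> R) (fun k => S j k) a b w].

Lemma measurable_network_stale a b : measurable (network_stale a b).
Proof.
have -> : network_stale a b =
    \bigcap_(j in [set: 'I_2]) stale (fun k => A j k : T -> R) (fun k => S j k) a b.
  by apply/seteqP; split => w H j => [_|]; exact: H.
by apply: fin_bigcap_measurable => // j _; exact: measurable_stale.
Qed.

Lemma probability_network_stale2 (a b a' b' : R) :
  0 <= a -> a <= b -> b <= a' -> a' <= b' ->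
  let H := age_tail (lam ord0) (lam (lift ord0 ord0))
                    (mu ord0) (mu (lift ord0 ord0)) in
  P (network_stale a b `&` network_stale a' b') = (H (b - a) * H (b' - a'))%:E.
Proof.
move=> a0 ab ba' ab' H.
pose beta := two_window_deadline a b a' b'.
pose W j := deadlines_met X (iA j) (iS j) beta.
pose J (j : 'I_2) : set (('I_2 * nat) + ('I_2 * nat)) :=
  [set x | match x with inl p => p.1 = j | inr p => p.1 = j end].
have mbeta : measurable_fun setT beta by exact: measurable_two_window_deadline.
have mX x : measurable_fun setT (X x : T -> R) by [].
(* The event of server [j] is measurable for the variables of that server, so the two events are
   independent. *)
have sW j : <<s cylinder (fun x => X x : T -> R) (J j) >> (W j).
  apply: (@measurable_deadlines_met _ _ _ _ X (iA j) (iS j) beta mbeta _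
    (g_sigma_algebraType (cylinder (fun x => X x : T -> R) (J j))) idfun) => k.
  - exact: (measurable_fun_cylinder (X := fun x => X x : T -> R)).
  - exact: (measurable_fun_cylinder (X := fun x => X x : T -> R)).
have mW j : measurable (W j).
  exact: (@measurable_deadlines_met _ _ _ _ X (iA j) (iS j) beta mbeta _ T idfun).
have PW j : P (W j) = (hypoexp (lam j) (mu j) (b - a) *
    hypoexp (lam j) (mu j) (b' - a'))%:E.
  apply: probability_two_window_deadlines => //.
  - by move=> k k' [].
  - by move=> k k' [].
  - by move=> k; exact: lawA.
  - by move=> k; exact: lawS.
have -> : P (network_stale a b `&` network_stale a' b') =
    P (W ord0 `&` W (lift ord0 ord0)).
  (* Equality is only almost sure, as [stale_two_windows] requires positive service times. *)
  apply: ae_eq_measure.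
  - by apply: measurableI; exact: measurable_network_stale.
  - exact: measurableI.
  apply: filterS ae_positive => w [_ S0].
  have st j := @stale_two_windows _ T R (fun k => A j k : T -> R)
    (fun k => S j k : T -> R) a b a' b' w ab ba' ab' (S0 j).
  split=> [[H1 H2]|[H1 H2]].
    by split=> k; apply/(st _).2.
  have Hj j : W j w.
    by case: (unliftP ord0 j) => [j' ->|->//]; rewrite (ord1 j').
  by split=> j; have [] := (st j).1 (Hj j).
rewrite (mutually_independent_disjoint mX indepX _ (sW _) (sW _)).
  by rewrite !PW -EFinM /H /age_tail; congr EFin; ring.
apply/seteqP; split=> // -[p|p] [/= -> /eqP];
  by rewrite (negbTE (neq_lift _ _)).
Qed.

End network.

(** * A strong law of large numbers *)

Section bounded_measurable.
Context d (T : measurableType d) (R : realType) (P : probability T R).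
Implicit Types f g : T -> R.

Definition bounded_measurable f :=
  measurable_fun setT f /\ exists M, forall x, `|f x| <= M.

Lemma bounded_measurable_integrable f :
  bounded_measurable f -> P.-integrable setT (EFin \o f).
Proof. by move=> [mf [M fM]]; exact: bounded_integrable fM. Qed.

Lemma bounded_measurable_cst c : bounded_measurable (cst c).
Proof. by split => //; exists `|c| => x. Qed.

Lemma bounded_measurable_indic (E : set T) : measurable E ->
  bounded_measurable (\1_E).
Proof.
move=> mE; split; first exact: measurable_indic.
by exists 1 => x; rewrite indicE; case: (_ \in _); rewrite ?normr1 ?normr0.
Qed.

Lemma bounded_measurableD f g : bounded_measurable f -> bounded_measurable g ->
  bounded_measurable (fun x => f x + g x).
Proof.
move=> [mf [M fM]] [mg [N gN]]; split; first exact: measurable_funD.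
by exists (M + N) => x; rewrite (le_trans (ler_normD _ _))// lerD.
Qed.

Lemma bounded_measurableM f g : bounded_measurable f -> bounded_measurable g ->
  bounded_measurable (fun x => f x * g x).
Proof.
move=> [mf [M fM]] [mg [N gN]]; split; first exact: measurable_funM.
by exists (M * N) => x; rewrite normrM ler_pM.
Qed.

Lemma bounded_measurable_sum I (s : seq I) (f : I -> T -> R) :
  (forall i, bounded_measurable (f i)) ->
  bounded_measurable (fun x => \sum_(i <- s) f i x).
Proof.
move=> bf; elim: s => [|i s IH].
  by under eq_fun do rewrite big_nil; exact: bounded_measurable_cst.
by under eq_fun do rewrite big_cons; exact: bounded_measurableD.
Qed.

Definition mean f : R := \int[P]_x f x.

Lemma meanD f g : bounded_measurable f -> bounded_measurable g ->
  mean (fun x => f x + g x) = mean (f) + mean (g).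
Proof.
by move=> bf bg; rewrite /mean RintegralD//; exact: bounded_measurable_integrable.
Qed.

Lemma meanZ c f : bounded_measurable f -> mean (fun x => c * f x) = c * mean (f).
Proof.
by move=> bf; rewrite /mean RintegralZl//; exact: bounded_measurable_integrable.
Qed.

Lemma mean_cst c : mean (cst c) = c.
Proof.
by rewrite /mean Rintegral_cst// [X in fine X](_ : _ = 1%E) ?mulr1//; exact: probability_setT.
Qed.

Lemma mean_sum I (s : seq I) (f : I -> T -> R) :
  (forall i, bounded_measurable (f i)) ->
  mean (fun x => \sum_(i <- s) f i x) = \sum_(i <- s) mean (f i).
Proof.
move=> bf; elim: s => [|i s IH].
  rewrite big_nil -[RHS](mean_cst 0); congr mean.
  by apply/funext => x; rewrite big_nil.
rewrite big_cons -IH -meanD//; last exact: bounded_measurable_sum.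
by congr mean; apply/funext => x; rewrite big_cons.
Qed.

Lemma mean_le f g : bounded_measurable f -> bounded_measurable g ->
  (forall x, f x <= g x) -> mean (f) <= mean (g).
Proof.
by move=> bf bg fg; apply: le_Rintegral => //; exact: bounded_measurable_integrable.
Qed.

Lemma mean_indic (E : set T) : measurable E -> mean (\1_E) = fine (P E).
Proof. by move=> mE; rewrite /mean /Rintegral integral_indic// setIT. Qed.

Lemma mean_fineK f : bounded_measurable f -> (\int[P]_x (f x)%:E = (mean (f))%:E)%E.
Proof.
move=> bf; rewrite /mean fineK//; apply: integrable_fin_num => //.
exact: bounded_measurable_integrable.
Qed.

Section variance_bound.
Variables (Z : nat -> T -> R) (m_ : nat -> R) (K q : R).
Hypotheses (bZ : forall k, bounded_measurable (Z k))
  (EZ : forall k, mean (Z k) = m_ k) (K0 : 0 <= K) (q0 : 0 <= q) (q1 : q < 1)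
  (covZ : forall k l,
     mean (fun w => Z k w * Z l w) <= m_ k * m_ l + K * q ^+ (k - l + (l - k))).

Lemma sum_exprn_le n : \sum_(i < n) q ^+ i <= (1 - q)^-1.
Proof.
have q1' : 0 < 1 - q by rewrite subr_gt0.
rewrite -[leRHS]mul1r ler_pdivlMr// mulrC.
rewrite (_ : (1 - q) * _ = 1 - q ^+ n) ?gerBl ?exprn_ge0//.
by rewrite -[1 - q ^+ n]opprB subrX1 -mulNr opprB.
Qed.

(** [k - l + (l - k)] is the distance between [k] and [l], as one of the truncated differences is 0.
    Each side of [k] contributes at most a geometric series, hence the 2. *)
Lemma sum_exprn_dist_le n k : (k < n)%N ->
  \sum_(l < n) q ^+ (k - l + (l - k)) <= 2 / (1 - q).
Proof.
move=> kn; rewrite -(big_mkord predT (fun l => q ^+ (k - l + (l - k)))).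
rewrite (@big_cat_nat _ _ _ k)//=; last exact: ltnW.
rewrite mulrDl mul1r; apply: lerD.
  rewrite big_mkord (le_trans _ (sum_exprn_le k))//.
  rewrite (reindex_inj rev_ord_inj)/=; apply: ler_sum => i _.
  have -> : (k - (k - i.+1) + (k - i.+1 - k) = i.+1)%N.
    by have := ltn_ord i; lia.
  by rewrite exprS ler_piMl ?exprn_ge0// ltW.
rewrite -{1}[k]add0n big_addn big_mkord (le_trans _ (sum_exprn_le (n - k)))//.
apply: ler_sum => i _; have -> : (k - (i + k) + (i + k - k) = i)%N by lia.
exact: lexx.
Qed.

Let centered k w := Z k w - m_ k.

Let bcentered k : bounded_measurable (centered k).
Proof. exact/bounded_measurableD/bounded_measurable_cst. Qed.

Lemma mean_centeredM k l :
  mean (fun w => centered k w * centered l w) =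
  mean (fun w => Z k w * Z l w) - m_ k * m_ l.
Proof.
have E w : centered k w * centered l w =
    (Z k w * Z l w + - m_ l * Z k w) + (- m_ k * Z l w + m_ k * m_ l).
  by rewrite /centered; ring.
have bM i j := bounded_measurableM (bZ i) (bZ j).
have bc (c : R) i : bounded_measurable (fun w => c * Z i w).
  by apply: bounded_measurableM => //; exact: bounded_measurable_cst.
rewrite (_ : (fun w => _) = fun w =>
    (Z k w * Z l w + - m_ l * Z k w) + (- m_ k * Z l w + m_ k * m_ l)); last first.
  exact/funext.
have bk : bounded_measurable (fun=> m_ k * m_ l) := bounded_measurable_cst _.
rewrite (meanD (bounded_measurableD (bM k l) (bc _ _)) (bounded_measurableD (bc _ _) bk)).
rewrite (meanD (bM k l) (bc _ _)) (meanD (bc _ _) bk).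
have mZ (c : R) i : mean (fun w => c * Z i w) = c * m_ i by rewrite meanZ// EZ.
rewrite !mZ.
by rewrite (mean_cst (m_ k * m_ l)); ring.
Qed.

Definition centered_sum n w := \sum_(k < n) (Z k w - m_ k).

(** Each row of the covariance matrix has a sum bounded independently of [n]. *)
Lemma mean_centered_sum_sqr n :
  mean (fun w => centered_sum n w ^+ 2) <= n%:R * (K * (2 / (1 - q))).
Proof.
rewrite (_ : (fun w => _) = fun w => \sum_(k < n) \sum_(l < n)
    centered k w * centered l w); last first.
  apply/funext => w; rewrite expr2 /centered_sum big_distrl/=.
  by apply: eq_bigr => k _; rewrite big_distrr.
have bM i j := bounded_measurableM (bcentered i) (bcentered j).
rewrite mean_sum; last by move=> i; exact: bounded_measurable_sum.
rewrite mulr_natl -[X in _ *+ X]card_ord -sumr_const; apply: ler_sum => k _.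
rewrite mean_sum//; apply: (@le_trans _ _ (\sum_(l < n) K * q ^+ (k - l + (l - k)))).
  by apply: ler_sum => l _; rewrite mean_centeredM lerBlDl.
by rewrite -mulr_sumr ler_wpM2l// sum_exprn_dist_le.
Qed.

End variance_bound.

Section strong_law.
Variables (Z : nat -> T -> R) (m_ : nat -> R) (m C : R).
Hypotheses (bZ : forall k, bounded_measurable (Z k)) (Z0 : forall k w, 0 <= Z k w)
  (m_m : m_ @ \oo --> m)
  (var_le : forall n, mean (fun w => centered_sum Z m_ n w ^+ 2) <= n%:R * C).

Let sq n := (n.+1 ^ 2)%N.

(** [f n] has mean at most [C * n.+1%:R ^- 2], so the series of the [f n] has a finite mean and
    converges almost surely; its terms then tend to 0. *)
Lemma ae_cvg_squares : {ae P, forall w,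
  (centered_sum Z m_ (sq n) w / (sq n)%:R) @[n --> \oo] --> (0 : R)}.
Proof.
pose f n w := (centered_sum Z m_ (sq n) w / (sq n)%:R) ^+ 2.
have bcs n : bounded_measurable (centered_sum Z m_ n).
  apply: bounded_measurable_sum => k.
  exact/bounded_measurableD/bounded_measurable_cst.
have bf n : bounded_measurable (f n).
  rewrite /f; under eq_fun do rewrite expr2.
  apply: bounded_measurableM; apply: bounded_measurableM => //;
    exact: bounded_measurable_cst.
have f0 n w : (0 <= (f n w)%:E)%E by rewrite lee_fin sqr_ge0.
have C0 : 0 <= C.
  have := var_le 1; rewrite mul1r; apply: le_trans.
  by apply: Rintegral_ge0 => w _; exact: sqr_ge0.
have Ef n : (\int[P]_w (f n w)%:E <= (C * (n.+1%:R ^- 2))%:E)%E.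
  rewrite mean_fineK// lee_fin.
  have -> : f n = fun w => ((sq n)%:R ^- 2) * (centered_sum Z m_ (sq n) w ^+ 2).
    by apply/funext => w; rewrite /f exprMn exprVn mulrC.
  rewrite meanZ; last first.
    by under eq_fun do rewrite expr2; exact: bounded_measurableM.
  rewrite mulrC ler_pdivrMr ?exprn_gt0 ?ltr0n//.
  rewrite (le_trans (var_le _))// /sq natrX.
  rewrite [leRHS](_ : _ = n.+1%:R ^+ 2 * C)//.
  by rewrite [X in _ * X]expr2 mulrA divfK ?expf_neq0 ?pnatr_eq0// mulrC.
have int_sum : (\int[P]_w (\sum_(0 <= n <oo) (f n w)%:E) < +oo)%E.
  rewrite integral_nneseries//; last first.
    by move=> n; apply: measurable_fun_EFin; exact: (bf n).1.
  apply: (@le_lt_trans _ _ (\sum_(0 <= n <oo) (C * (n.+1%:R ^- 2))%:E)%E).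
    apply: lee_nneseries => n _ *; [exact: integral_ge0|exact: Ef].
  (* Telescoping, from [(a + 1) ^- 2 <= a^-1 - (a + 1)^-1]. *)
  have sum_le n : \sum_(0 <= i < n.+1) (i.+1%:R ^- 2 : R) <= 2 - n.+1%:R^-1.
    elim: n => [|n IH]; first by rewrite big_nat1 expr1n invr1; lra.
    rewrite big_nat_recr//= (le_trans (lerD IH (lexx _)))//.
    set a : R := n.+1%:R; have a0 : 0 < a by rewrite ltr0n.
    have -> : n.+2%:R = a + 1 by rewrite /a natr1.
    have : (a + 1) ^- 2 <= a^-1 - (a + 1)^-1.
      rewrite (_ : a^-1 - (a + 1)^-1 = (a * (a + 1))^-1); last first.
        by field; rewrite !gt_eqF// ltr_wpDr.
      rewrite lef_pV2 ?posrE ?exprn_gt0 ?mulr_gt0 ?ltr_wpDr//.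
      by rewrite expr2 ler_wpM2r ?addr_ge0 ?lerDl// ltW.
    by move=> h; rewrite (le_trans (lerD (lexx _) h))// addrA subrK.
  have C0n n : 0 <= C * n.+1%:R ^- 2 by rewrite mulr_ge0// invr_ge0 exprn_ge0.
  apply: (@le_lt_trans _ _ (C * 2)%:E); last exact: ltry.
  apply: lime_le; first by apply: is_cvg_nneseries => n _ _; rewrite lee_fin.
  exists 1%N => // -[//|n] _.
  rewrite sumEFin lee_fin -mulr_sumr ler_wpM2l// (le_trans (sum_le n))//.
  by rewrite gerBl invr_ge0.
have mf n : measurable_fun setT (fun w => (f n w)%:E).
  by apply: measurable_fun_EFin; exact: (bf n).1.
have int_f : P.-integrable setT (fun w => \sum_(0 <= n <oo) (f n w)%:E)%E.
  apply/integrableP; split; first exact: ge0_emeasurable_sum.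
  under eq_integral do rewrite gee0_abs ?nneseries_ge0//.
  exact: int_sum.
have := integrable_ae measurableT int_f.
apply: filterS => w /(_ Logic.I) fw.
have : cvgn (series (fun n => f n w)).
  apply: nnseries_is_cvg => [n|]; first exact: sqr_ge0.
  by rewrite -ge0_fin_numE// nneseries_ge0.
move/cvg_series_cvg_0 => /cvgr0Pnorm_lt fw0.
apply/cvgr0Pnorm_lt => e e0.
have e20 : 0 < e ^+ 2 by rewrite exprn_gt0.
apply: filterS (fw0 _ e20) => n; rewrite /f normrX.
by rewrite ltr_pXn2r// nnegrE// ltW.
Qed.

End strong_law.
End bounded_measurable.

(** * Averages between consecutive squares *)

Section averages.
Context {R : realType}.

Lemma sqrn_bracket N : (0 < N)%N ->
  exists n, ((n.+1 ^ 2 <= N) && (N < n.+2 ^ 2))%N.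
Proof.
move=> N0; have ex : exists n, (n.+1 ^ 2 <= N)%N by exists 0%N.
have ub n : (n.+1 ^ 2 <= N)%N -> (n <= N)%N by nia.
exists (ex_maxn ex ub); case: ex_maxnP => n -> /(_ n.+1) h /=.
by rewrite ltnNge; apply/negP => /h; rewrite ltnn.
Qed.

Lemma cvg_sqrn_pred : (fun n => (n.+1 ^ 2).-1)%N @ \oo --> \oo.
Proof.
apply/cvgnyPge => A; exists A => // n /= An.
by rewrite (leq_trans An)//; lia.
Qed.

Lemma cvg_ratio_succ : (n.+1%:R / n.+2%:R : R) @[n --> \oo] --> (1 : R).
Proof.
have -> : (fun n => n.+1%:R / n.+2%:R : R) = (fun n => 1 - n.+2%:R^-1).
  apply/funext => n; rewrite -[n.+2%:R]natr1.
  by field; rewrite gt_eqF.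
rewrite -[X in _ --> X]subr0; apply: cvgB; first exact: cvg_cst.
by have := @cvg_harmonic R; rewrite -cvg_shiftS.
Qed.

Lemma cvg_ratio_pred : (n.+2%:R / n.+1%:R : R) @[n --> \oo] --> (1 : R).
Proof.
rewrite -[X in _ --> X]invr1; under eq_fun do rewrite -invf_div.
by apply: cvgV; [exact: oner_neq0|exact: cvg_ratio_succ].
Qed.

(** Nonnegative terms make the partial sums monotone, so the average at [N] lies between averages at
    the neighbouring squares, up to the ratio of these squares, which tends to 1. *)
Lemma cvg_average_of_squares (a : nat -> R) (m : R) : (forall k, 0 <= a k) ->
  ((\sum_(k < n.+1 ^ 2) a k) / (n.+1 ^ 2)%:R) @[n --> \oo] --> m ->
  ((\sum_(k < n) a k) / n%:R) @[n --> \oo] --> m.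
Proof.
move=> a0 cs.
pose A n := \sum_(k < n) a k.
have A_mono i j : (i <= j)%N -> A i <= A j.
  move=> ij; rewrite /A -(subnKC ij) big_split_ord/= lerDl.
  exact: sumr_ge0.
have A0 n : 0 <= A n by exact: sumr_ge0.
have ratio (x u v : R) : u != 0 -> v != 0 ->
    x / v ^+ 2 = x / u ^+ 2 * (u / v * (u / v)).
  by move=> u0 v0; field; rewrite u0 v0.
have clo : (A (n.+1 ^ 2)%N / (n.+2 ^ 2)%:R) @[n --> \oo] --> m.
  rewrite -[m]mulr1 -[X in m * X](mulr1 1).
  have -> : (fun n => A (n.+1 ^ 2)%N / (n.+2 ^ 2)%:R) = fun n =>
      A (n.+1 ^ 2)%N / (n.+1 ^ 2)%:R * (n.+1%:R / n.+2%:R * (n.+1%:R / n.+2%:R)).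
    by apply/funext => n; rewrite !natrX -ratio ?pnatr_eq0.
  by apply: cvgM => //; apply: cvgM; exact: cvg_ratio_succ.
have chi : (A (n.+2 ^ 2)%N / (n.+1 ^ 2)%:R) @[n --> \oo] --> m.
  rewrite -[m]mulr1 -[X in m * X](mulr1 1).
  have -> : (fun n => A (n.+2 ^ 2)%N / (n.+1 ^ 2)%:R) = fun n =>
      A (n.+2 ^ 2)%N / (n.+2 ^ 2)%:R * (n.+2%:R / n.+1%:R * (n.+2%:R / n.+1%:R)).
    by apply/funext => n; rewrite !natrX -ratio ?pnatr_eq0.
  apply: cvgM; last by apply: cvgM; exact: cvg_ratio_pred.
  by have := cs; rewrite -cvg_shiftS.
apply/cvgrPdist_le => e e0.
move/cvgrPdist_le : clo => /(_ _ e0)[n1 _ h1].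
move/cvgrPdist_le : chi => /(_ _ e0)[n2 _ h2].
exists ((maxn n1 n2).+1 ^ 2)%N => // N /= nN.
have [|n /andP[nN1 nN2]] := @sqrn_bracket N.
  by rewrite (leq_trans _ nN)// expn_gt0.
have nn : (maxn n1 n2 <= n)%N by nia.
have lo := h1 n (leq_trans (leq_maxl _ _) nn).
have hi := h2 n (leq_trans (leq_maxr _ _) nn).
have N0 : (0 < N)%N by rewrite (leq_trans _ nN1)// expn_gt0.
have l1 : A (n.+1 ^ 2)%N / (n.+2 ^ 2)%:R <= A N / N%:R.
  rewrite ler_pM ?invr_ge0 ?A_mono// lef_pV2 ?posrE ?ltr0n ?expn_gt0//.
  by rewrite ler_nat ltnW.
have l2 : A N / N%:R <= A (n.+2 ^ 2)%N / (n.+1 ^ 2)%:R.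
  rewrite ler_pM ?invr_ge0 ?A_mono ?(ltnW nN2)// lef_pV2 ?posrE ?ltr0n ?expn_gt0//.
  by rewrite ler_nat.
move: lo hi; rewrite !ler_distl => /andP[lo1 lo2] /andP[hi1 hi2].
rewrite -/(A N); apply/andP; split.
  by rewrite (le_trans _ hi1)// lerB.
by rewrite (le_trans lo2)// lerD.
Qed.
End averages.

Section strong_law_of_large_numbers.
Context d (T : measurableType d) (R : realType) (P : probability T R).
Variables (Z : nat -> T -> R) (m_ : nat -> R) (m C : R).
Hypotheses (bZ : forall k, bounded_measurable (Z k)) (Z0 : forall k w, 0 <= Z k w)
  (m_m : m_ @ \oo --> m)
  (var_le : forall n, mean P (fun w => centered_sum Z m_ n w ^+ 2) <= n%:R * C).

Lemma ae_cvg_average : {ae P, forall w,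
  ((\sum_(k < n) Z k w) / n%:R) @[n --> \oo] --> m}.
Proof.
apply: filterS (ae_cvg_squares bZ var_le) => w cw.
apply: (@cvg_average_of_squares _ (fun k => Z k w)) => //.
(* The averaged means converge by Cesaro; [arithmetic_mean] at [n] has [n.+1] terms, hence the
   predecessor. *)
have cm : ((\sum_(k < n.+1 ^ 2) m_ k) / (n.+1 ^ 2)%:R) @[n --> \oo] --> m.
  rewrite (_ : (fun n => _) =
      arithmetic_mean m_ \o (fun n => (n.+1 ^ 2).-1)%N).
    exact: cvg_comp cvg_sqrn_pred (cesaro m_m).
  apply/funext => n.
  transitivity ((n.+1 ^ 2).-1.+1%:R^-1 * series m_ (n.+1 ^ 2).-1.+1) => //.
  by rewrite prednK ?expn_gt0// /series/= big_mkord mulrC.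
rewrite -[m]add0r (_ : (fun n => _) = fun n =>
    centered_sum Z m_ (n.+1 ^ 2) w / (n.+1 ^ 2)%:R +
    (\sum_(k < n.+1 ^ 2) m_ k) / (n.+1 ^ 2)%:R); first exact: cvgD cw cm.
apply/funext => n.
by rewrite -mulrDl /centered_sum sumrB subrK.
Qed.

End strong_law_of_large_numbers.

(** * The counts of stale windows *)

Section lattice.
Context d (T : measurableType d) (R : realType) (P : probability T R)
  (lam mu : 'I_2 -> R) (A S : 'I_2 -> nat -> {RV P >-> R}).
Hypotheses (lam0 : forall j, 0 < lam j) (mu0 : forall j, 0 < mu j)
  (lawA : forall j k, is_exponential P (A j k) (lam j))
  (lawS : forall j k, is_exponential P (S j k) (mu j))
  (indep : mutually_independent P
    (fun x : ('I_2 * nat) + ('I_2 * nat) =>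
       match x with
       | inl (j, k) => (A j k : T -> R)
       | inr (j, k) => (S j k : T -> R)
       end)).

Let H := age_tail (lam ord0) (lam (lift ord0 ord0))
                  (mu ord0) (mu (lift ord0 ord0)).
Let stale2 := network_stale A S.
Let P2 := probability_network_stale2 lam0 mu0 lawA lawS indep.

Lemma probability_network_stale (a b : R) : 0 <= a -> a <= b ->
  P (stale2 a b) = (H (b - a))%:E.
Proof.
(* A single window is a pair whose second window ]b, b] is empty, hence almost surely stale. *)
move=> a0 ab; have := P2 a0 ab (lexx b) (lexx b).
rewrite /= subrr age_tail0 mulr1 => <-.
apply: ae_eq_measure; try by [|apply: measurableI]; try exact: measurable_network_stale.
  by apply: measurableI; exact: measurable_network_stale.
apply: filterS (ae_positive lawA lawS) => w [_ S0]; split=> [H1|[]//].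
split=> // j k [_ b1 b2]; suff : b < b by rewrite ltxx.
by apply: (lt_le_trans b1); apply: le_trans b2; rewrite lerDl ltW// S0.
Qed.

(** The converse fails, as an update generated in ]a, b] may be delivered in ]b, c]; this direction
    is the one that bounds covariances from above. *)
Lemma network_stale_split (a b c : R) : a <= b -> b <= c ->
  stale2 a c `<=` stale2 a b `&` stale2 b c.
Proof.
move=> ab bc w Hac; split=> j k [SA h1 h2]; apply: (Hac j k); split=> //.
  exact: le_trans bc.
exact: le_lt_trans h1.
Qed.

Variable h : R.
Hypothesis h0 : 0 < h.

Definition stale_indic i k : T -> R :=
  \1_(stale2 ((k - i.+1)%:R * h) (k%:R * h)).
(** With [i < k] the window starts at a nonnegative multiple of [h], so that [k - i.+1] is not
    truncated and the probability of staleness depends on the length alone. *)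
Definition stale_count k w : R := \sum_(i < k) stale_indic i k w.
Let p i := H (i.+1%:R * h).
Definition mean_stale_count k : R := \sum_(i < k) H (i.+1%:R * h).

Let mstale a b : measurable (stale2 a b).
Proof. exact: measurable_network_stale. Qed.

Lemma stale_indic01 i k w : 0 <= stale_indic i k w <= 1.
Proof. by rewrite /stale_indic indicE; case: (_ \in _); rewrite !lexx ler01. Qed.

Lemma bounded_measurable_stale_indic i k : bounded_measurable (stale_indic i k).
Proof. exact: bounded_measurable_indic. Qed.

Lemma bounded_measurable_stale_count k : bounded_measurable (stale_count k).
Proof.
by apply: bounded_measurable_sum => i; exact: bounded_measurable_stale_indic.
Qed.

Let mulh_ge0 k : 0 <= k%:R * h.
Proof. by rewrite mulr_ge0// ltW. Qed.

Let mulh_le i k : (i <= k)%N -> i%:R * h <= k%:R * h.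
Proof. by move=> ik; rewrite ler_pM2r// ler_nat. Qed.

Let mulhB i k : (i <= k)%N -> k%:R * h - (k - i)%:R * h = i%:R * h.
Proof. by move=> ik; rewrite -mulrBl natrB// opprB addrCA subrr addr0. Qed.

Lemma mean_stale_countE k : mean P (stale_count k) = mean_stale_count k.
Proof.
rewrite mean_sum; last by move=> i; exact: bounded_measurable_stale_indic.
apply: eq_bigr => i _; rewrite mean_indic//.
by rewrite probability_network_stale ?mulh_le ?leq_subr// mulhB.
Qed.

Let stale_lag k l : T -> R := \1_(stale2 (k%:R * h) (l%:R * h)).

Let blag k l : bounded_measurable (stale_lag k l).
Proof. exact: bounded_measurable_indic. Qed.

Let indic_le (E F G : set T) w : E `<=` F `&` G ->
  (\1_E w : R) <= \1_F w * \1_G w.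
Proof.
move=> EFG; rewrite !indicE; case: (boolP (w \in E)) => [|_].
  by rewrite inE => /EFG[wF wG]; rewrite !mem_set// mulr1.
by rewrite mulr_ge0.
Qed.

Let mean_indicM (E F : set T) : measurable E -> measurable F ->
  mean P (fun w => \1_E w * \1_F w) = fine (P (E `&` F)).
Proof.
move=> mE mF; rewrite -mean_indic; last exact: measurableI.
by congr mean; apply/funext => w; rewrite indicI.
Qed.

(** Among the windows that end at [l * h], those of index below [l - k] start at [k * h] or later.
    The others are cut at [k * h], and all share the same later piece. *)
Lemma stale_count_split k l w : (k <= l)%N ->
  stale_count l w <= \sum_(i < l - k) stale_indic i l w +
                     stale_lag k l w * stale_count k w.
Proof.
move=> kl; rewrite /stale_count -(big_mkord predT (fun i => stale_indic i l w)).
rewrite (@big_cat_nat _ _ _ (l - k))//= ?leq_subr// big_mkord lerD2l.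
rewrite -{1}[(l - k)%N]add0n big_addn subKn// big_mkord mulr_sumr.
apply: ler_sum => i _; rewrite mulrC; have ik := ltn_ord i.
have -> : stale_indic (i + (l - k)) l =
    \1_(stale2 ((k - i.+1)%:R * h) (l%:R * h)).
  by rewrite /stale_indic; congr (\1_(stale2 (_%:R * h) _)); lia.
by apply: indic_le; apply: network_stale_split; apply: mulh_le => //; exact: leq_subr.
Qed.

Lemma stale_indicM_le i j k w :
  stale_indic i k w * stale_indic j k w <= stale_indic (maxn i j) k w.
Proof.
have /andP[i0 i1] := stale_indic01 i k w.
have /andP[j0 j1] := stale_indic01 j k w.
by case: (leqP i j) => _; [exact: ler_piMl|exact: ler_piMr].
Qed.

Section covariance.
Variables (C q : R).
Hypotheses (q0 : 0 < q) (q1 : q < 1) (C0 : 0 < C)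
  (HC : forall i, H (i%:R * h) <= C * q ^+ (2 * i)).

Let K := C * ((1 - q)^-1 * (1 - q)^-1).

Let K0 : 0 < K.
Proof. by rewrite !mulr_gt0// invr_gt0 subr_gt0. Qed.

Let H0 i : 0 <= H (i%:R * h).
Proof. exact: age_tail_ge0. Qed.

Let sum_max k : \sum_(i < k) \sum_(j < k) p (maxn i j) <= K.
Proof.
(* From [i + j <= 2 * (maxn i j).+1]: the exponent [2 * i] in [HC] splits the double sum into two
   geometric series. *)
apply: (@le_trans _ _ (\sum_(i < k) \sum_(j < k) C * (q ^+ i * q ^+ j))).
  apply: ler_sum => i _; apply: ler_sum => j _.
  rewrite (le_trans (HC _))// ler_wpM2l ?(ltW C0)// -exprD.
  apply: ler_wiXn2l; [exact: ltW|exact: ltW|lia].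
under eq_bigr do rewrite -mulr_sumr -mulr_sumr.
rewrite -mulr_sumr -mulr_suml /K ler_wpM2l ?(ltW C0)//.
by rewrite ler_pM ?sumr_ge0 ?sum_exprn_le// => *; rewrite ?exprn_ge0 ?ltW.
Qed.

Let countM_le k w : stale_count k w * stale_count k w <=
  \sum_(i < k) \sum_(j < k) stale_indic (maxn i j) k w.
Proof.
rewrite /stale_count mulr_suml; apply: ler_sum => i _; rewrite mulr_sumr.
by apply: ler_sum => j _; exact: stale_indicM_le.
Qed.

(** For [k < l], each window after [k * h] is independent of each window that ends there, which
    gives at most the product of the means. The remaining windows force the gap between [k * h] and
    [l * h] to be stale, which multiplies the second moment bound [K] by [C * q ^+ (l - k)]. The
    diagonal needs [K] alone, hence [K * (C + 1)]. *)
Lemma mean_stale_countM k l :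
  mean P (fun w => stale_count k w * stale_count l w) <=
  mean_stale_count k * mean_stale_count l +
  K * (C + 1) * q ^+ (k - l + (l - k)).
Proof.
wlog kl : k l / (k <= l)%N.
  move=> W; case: (leqP k l) => [|/ltnW] kl; first exact: W.
  rewrite mulrC addnC (_ : (fun w => _) = fun w => stale_count l w * stale_count k w).
    exact: W.
  by apply/funext => w; rewrite mulrC.
have bmax k' : bounded_measurable (fun w =>
    \sum_(i < k') \sum_(j < k') stale_indic (maxn i j) k' w).
  apply: bounded_measurable_sum => i; apply: bounded_measurable_sum => j.
  exact: bounded_measurable_stale_indic.
have bc := bounded_measurable_stale_count.
have m0 k' : 0 <= mean_stale_count k' by apply: sumr_ge0 => i _; exact: H0.
move: kl; rewrite leq_eqVlt => /predU1P[->|kl].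
  rewrite subnn expr0 mulr1.
  apply: (@le_trans _ _ K); last first.
    rewrite (le_trans _ (ler_wpDl (mulr_ge0 (m0 _) (m0 _)) (lexx _)))//.
    by rewrite ler_peMr ?(ltW K0)// lerDr ltW.
  apply: (le_trans (mean_le P (bounded_measurableM (bc _) (bc _)) (bmax l)
    (countM_le l))).
  rewrite mean_sum; last first.
    by move=> i; apply: bounded_measurable_sum => j; exact: bounded_measurable_stale_indic.
  apply: le_trans (sum_max l); apply: ler_sum => i _.
  rewrite mean_sum; last by move=> j; exact: bounded_measurable_stale_indic.
  apply: ler_sum => j _; rewrite mean_indic//.
  rewrite probability_network_stale ?mulh_le ?leq_subr// mulhB//.
  by rewrite gtn_max !ltn_ord.
have lagl : (l - k <= l)%N by exact: leq_subr.
have bX := bounded_measurable_stale_indic.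
have b1 : bounded_measurable (fun w => \sum_(j < k) \sum_(i < l - k)
    stale_indic j k w * stale_indic i l w).
  by apply: bounded_measurable_sum => j; apply: bounded_measurable_sum => i;
    exact: bounded_measurableM.
have b2 : bounded_measurable (fun w => \sum_(i < k) \sum_(j < k)
    stale_indic (maxn i j) k w * stale_lag k l w).
  by apply: bounded_measurable_sum => j; apply: bounded_measurable_sum => i;
    exact: bounded_measurableM.
apply: (@le_trans _ _ (mean P (fun w =>
    \sum_(j < k) \sum_(i < l - k) stale_indic j k w * stale_indic i l w +
    \sum_(i < k) \sum_(j < k) stale_indic (maxn i j) k w * stale_lag k l w))).
  apply: mean_le => [||w]; [exact: bounded_measurableM|exact: bounded_measurableD|].
  have k0 : 0 <= stale_count k w.
    by apply: sumr_ge0 => i _; have /andP[] := stale_indic01 i k w.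
  rewrite (le_trans (ler_wpM2l k0 (stale_count_split w (ltnW kl))))//.
  rewrite mulrDr; apply: lerD.
    rewrite mulr_suml; apply: ler_sum => j _; rewrite mulr_sumr.
    exact: lexx.
  have lag0 : 0 <= stale_lag k l w by rewrite /stale_lag indicE.
  rewrite mulrCA mulrC (le_trans (ler_wpM2r lag0 (countM_le k w)))//.
  by rewrite mulr_suml; apply: ler_sum => i _; rewrite mulr_suml.
rewrite meanD//; apply: lerD.
  rewrite mean_sum; last first.
    by move=> j; apply: bounded_measurable_sum => i; exact: bounded_measurableM.
  rewrite (le_trans _ (ler_wpM2l (m0 k) (_ : mean_stale_count (l - k) <= _)))//.
    rewrite mulr_suml; apply: ler_sum => j _; rewrite mean_sum; last first.
      by move=> i; exact: bounded_measurableM.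
    rewrite mulr_sumr; apply: ler_sum => i _; rewrite mean_indicM//.
    rewrite P2 ?mulh_le ?leq_subr//; last by have := ltn_ord i; lia.
    by rewrite !mulhB//= (leq_trans (ltn_ord i)).
  rewrite /mean_stale_count -!(big_mkord predT (fun i => H (i.+1%:R * h))).
  rewrite (@big_cat_nat _ _ _ (l - k) 0 l)//= lerDl.
  by apply: sumr_ge0 => i _; exact: H0.
rewrite (eqP (ltnW kl : k - l == 0)%N) add0n.
rewrite mean_sum; last first.
  by move=> j; apply: bounded_measurable_sum => i; exact: bounded_measurableM.
apply: (@le_trans _ _ (\sum_(i < k) \sum_(j < k) p (maxn i j) * (C * q ^+ (l - k)))).
  apply: ler_sum => i _; rewrite mean_sum; last first.
    by move=> j; exact: bounded_measurableM.
  apply: ler_sum => j _; rewrite mean_indicM//.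
  rewrite P2 ?mulh_le ?leq_subr ?(ltnW kl)//=.
  rewrite mulhB ?gtn_max ?ltn_ord// -mulrBl -natrB ?(ltnW kl)//.
  rewrite ler_wpM2l ?H0// (le_trans (HC _))// ler_wpM2l ?(ltW C0)//.
  by apply: ler_wiXn2l; [exact: ltW|exact: ltW|lia].
under eq_bigr do rewrite -mulr_suml.
rewrite -mulr_suml.
have e0 : 0 <= C * q ^+ (l - k) by rewrite mulr_ge0 ?exprn_ge0// ltW.
rewrite (le_trans (ler_wpM2r e0 (sum_max k)))// mulrA ler_wpM2r ?exprn_ge0 ?(ltW q0)//.
by rewrite ler_wpM2l ?(ltW K0)// lerDl.
Qed.

End covariance.

Let G := age_tail_integral (lam ord0) (lam (lift ord0 ord0))
                           (mu ord0) (mu (lift ord0 ord0)).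

Let H0 i : 0 <= H (i%:R * h).
Proof. exact: age_tail_ge0. Qed.

(** [h * mean_stale_count k] is the right Riemann sum of a nonincreasing tail; the left one exceeds
    it by at most [h], as the tail is 1 at 0. *)
Lemma mean_stale_count_bounds k :
  h * mean_stale_count k <= G 0 - G (k%:R * h) /\
  G 0 - G (k%:R * h) <= h + h * mean_stale_count k.
Proof.
have step i := age_tail_integral_step (lam0 ord0) (lam0 (lift ord0 ord0))
  (mu0 ord0) (mu0 (lift ord0 ord0)) (mulh_ge0 i) (ltW h0).
have hS i : i%:R * h + h = i.+1%:R * h by rewrite -natr1 mulrDl mul1r.
split.
  elim: k => [|k IH].
    by rewrite /mean_stale_count big_ord0 mulr0 mul0r subrr.
  rewrite /mean_stale_count big_ord_recr/= mulrDr.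
  have [] := step k; rewrite hS => s1 _.
  by rewrite (le_trans (lerD IH s1))// addrA subrK.
apply: (@le_trans _ _ (h * \sum_(i < k) H (i%:R * h))).
  elim: k => [|k IH]; first by rewrite big_ord0 mulr0 mul0r subrr.
  rewrite big_ord_recr/= mulrDr.
  have [_] := step k; rewrite hS => s1.
  by rewrite (le_trans _ (lerD IH s1))// addrA subrK.
rewrite -[X in X + _]mulr1 -mulrDr ler_wpM2l ?(ltW h0)//.
rewrite (@le_trans _ _ (\sum_(i < k.+1) H (i%:R * h)))//.
  by rewrite big_ord_recr/= lerDl.
by rewrite big_ord_recl mul0r /H age_tail0.
Qed.

Lemma ae_average_stale_count : exists c : R,
  [/\ h * c <= G 0, G 0 <= h + h * c &
   {ae P, forall w, (\sum_(k < n) stale_count k w) / n%:R @[n --> \oo] --> c}].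
Proof.
have [C [b [C0 b0 decay]]] := age_tail_decay (lam0 ord0) (lam0 (lift ord0 ord0))
  (mu0 ord0) (mu0 (lift ord0 ord0)).
(* Half of the decay rate, to meet the exponent [2 * i] of the covariance bound. *)
pose q := expR (- b * h / 2).
have q0 : 0 < q by exact: expR_gt0.
have q1 : q < 1.
  by rewrite /q -expR0 ltr_expR mulNr mulNr oppr_lt0 divr_gt0// mulr_gt0.
have qE i : expR (- b * (i%:R * h)) = q ^+ (2 * i).
  rewrite /q -expRM_natl natrM; congr expR.
  by field.
have G0 i : 0 <= G (i%:R * h) by exact: age_tail_integral_ge0.
have nd : nondecreasing_seq mean_stale_count.
  apply/nondecreasing_seqP => n.
  by rewrite /mean_stale_count big_ord_recr/= lerDl.
have ub n : mean_stale_count n <= G 0 / h.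
  have [le1 _] := mean_stale_count_bounds n.
  by rewrite ler_pdivlMr// mulrC (le_trans le1)// gerBl.
have cm : cvgn mean_stale_count.
  by apply: nondecreasing_is_cvgn => //; exists (G 0 / h) => _ [n _ <-].
exists (limn mean_stale_count); split.
- rewrite mulrC -ler_pdivlMr//; apply: limr_le => //; exact: nearW.
- have cG : (G (k%:R * h) + (h + h * limn mean_stale_count)) @[k --> \oo] -->
      (0 + (h + h * limn mean_stale_count)).
    apply: cvgD; last exact: cvg_cst.
    apply: (@squeeze_cvgr _ _ _ _ (cst 0) (fun k => C * (q ^+ 2) ^+ k)).
    + apply: nearW => k; rewrite G0/= -exprM -qE.
      by have [] := decay _ (mulh_ge0 k).
    + exact: cvg_cst.
    + rewrite -[X in _ --> X](mulr0 C); apply: cvgM; first exact: cvg_cst.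
      apply: cvg_expr; rewrite ger0_norm ?exprn_ge0 ?(ltW q0)//.
      by rewrite exprn_ilt1// ltW.
  rewrite -[X in _ <= X]add0r; apply: (cvgr_to_ge cG); apply: nearW => k.
  have [_ le2] := mean_stale_count_bounds k.
  move: le2; rewrite lerBlDl => /le_trans; apply.
  rewrite lerD2l lerD2l ler_wpM2l ?(ltW h0)//.
  exact: nondecreasing_cvgn_le.
- have HC i : H (i%:R * h) <= C * q ^+ (2 * i).
    by rewrite -qE; have [] := decay _ (mulh_ge0 i).
  apply: (ae_cvg_average (m_ := mean_stale_count)) => //.
  + exact: bounded_measurable_stale_count.
  + move=> k w; apply: sumr_ge0 => i _; by have /andP[] := stale_indic01 i k w.
  + move=> n; apply: (mean_centered_sum_sqr bounded_measurable_stale_count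
      mean_stale_countE _ (ltW q0) q1 (mean_stale_countM q0 q1 C0 HC)).
    by rewrite !mulr_ge0 ?invr_ge0 ?subr_ge0 ?addr_ge0 ?(ltW C0) ?(ltW q1).
Qed.

End lattice.

(** * Sample paths of the age *)

Section sample_path.
Context {R : realType} (n : nat) (A S : 'I_n -> nat -> R).
Hypothesis S0 : forall j k, 0 < S j k.
Implicit Types (s t x : R).

Let fresh := freshest A S.
Let delta := age A S.

Let delivered_by t : set R := [set 0] `|` [set g | exists j k,
  delivered A S j k /\ delivery_time A S j k <= t /\ g = gen_time A j k].

Let delivered_by_sup t : has_sup (delivered_by t).
Proof.
split; first by exists 0; left.
(* Positive service times bound the delivered generation times by [t], so that the supremum is a
   genuine one. *)
exists (Num.max 0 t) => _ [->|[j [k [_ [dt ->]]]]]; first by rewrite le_max lexx.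
by rewrite le_max (le_trans _ dt) ?orbT// /delivery_time lerDl ltW.
Qed.

Lemma freshest_le t x : 0 <= x ->
  (fresh t <= x) <-> (forall j k, delivered A S j k ->
     delivery_time A S j k <= t -> gen_time A j k <= x).
Proof.
move=> x0; split=> [ft j k dl dt|H].
  apply: le_trans ft; apply: ub_le_sup; first by case: (delivered_by_sup t).
  by right; exists j, k.
apply: sup_le_ub; first by case: (delivered_by_sup t).
by move=> _ [->//|[j [k [dl [dt ->]]]]]; exact: H dl dt.
Qed.

Lemma freshest_ge0 t : 0 <= fresh t.
Proof. by apply: ub_le_sup; [case: (delivered_by_sup t)|left]. Qed.

Lemma freshest_nondecreasing : nondecreasing_fun fresh.
Proof.
move=> s t st; apply/(freshest_le _ (freshest_ge0 t)) => j k dl ds.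
apply: ub_le_sup; first by case: (delivered_by_sup t).
by right; exists j, k; split => //; split => //; exact: le_trans st.
Qed.

Lemma age_growth s t : s <= t -> delta t <= delta s + (t - s).
Proof.
by move=> st; have := freshest_nondecreasing st; rewrite /delta /age -/fresh; lra.
Qed.

Lemma age_le t : delta t <= t.
Proof. by rewrite /delta /age gerBl freshest_ge0. Qed.

Lemma age_ge0 t : 0 <= t -> 0 <= delta t.
Proof.
move=> t0; rewrite /delta /age subr_ge0; apply/freshest_le => // j k _.
by apply: le_trans; rewrite /delivery_time lerDl ltW.
Qed.

(** The condition [x <= t] reflects the initial value 0 of [freshest], which keeps the age at [t]
    below [t]. *)
Lemma age_ge t x : x <= t -> (x <= delta t) <-> (forall j k,
  ~ [/\ S j k < A j k.+1, t - x < gen_time A j k & gen_time A j k + S j k <= t]).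
Proof.
move=> xt; rewrite /delta /age lerBrDl addrC -lerBrDl.
rewrite (freshest_le t (x := t - x)) ?subr_ge0//; split=> [H j k [dl lo dt]|H j k dl dt].
  by have := H j k dl dt; rewrite leNgt lo.
by rewrite leNgt; apply/negP => lo; apply: (H j k).
Qed.

Lemma measurable_age : measurable_fun setT delta.
Proof.
by apply: measurable_funB => //; apply: nondecreasing_measurable => //;
  exact: freshest_nondecreasing.
Qed.

Variable h : R.
Hypothesis h0 : 0 < h.

Definition age_count k : R :=
  \sum_(i < k) (i.+1%:R * h <= delta (k%:R * h))%R%:R.

Lemma age_count_bounds k :
  h * age_count k <= delta (k%:R * h) <= h * age_count k + h.
Proof.
set D := delta _; have D0 : 0 <= D by rewrite age_ge0// mulr_ge0// ltW.
have Dk : D <= k%:R * h by exact: age_le.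
pose f i : R := \sum_(j < i) (j.+1%:R * h <= D)%R%:R.
(* The summands are 1 as long as the multiple of [h] is at most [D], and 0 beyond; the induction
   follows the two regimes. *)
have claim i : (i%:R * h <= D -> f i = i%:R) /\
    (D < i%:R * h -> h * f i <= D <= h * f i + h).
  elim: i => [|i [IH1 IH2]].
    by split => [_|]; [rewrite /f big_ord0|rewrite mul0r ltNge D0].
  have ii : i%:R * h <= i.+1%:R * h by rewrite ler_pM2r// ler_nat.
  have fS : f i.+1 = f i + (i.+1%:R * h <= D)%R%:R by rewrite /f big_ord_recr.
  split=> [iD|Di]; first by rewrite fS iD IH1 ?natr1// (le_trans ii).
  rewrite fS (lt_geF Di) addr0; case: (leP (i%:R * h) D) => [iD|]; last exact: IH2.
  rewrite IH1// mulrC iD/= (le_trans (ltW Di))//.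
  by rewrite -natr1 mulrDl mul1r.
rewrite /age_count -/D -/(f k); have [c1 c2] := claim k.
move: Dk; rewrite le_eqVlt => /predU1P[Dk|/c2//].
by rewrite c1 ?Dk// mulrC lexx/= lerDl ltW.
Qed.

Local Notation mu := (@lebesgue_measure R).

Let F (T : R) : \bar R := (\int[mu]_(t in `[0%R, T]) (delta t)%:E)%E.

Let mdelta (B : set R) : measurable_fun B (fun t => (delta t)%:E).
Proof. by apply: measurable_fun_EFin; apply: measurable_funTS; exact: measurable_age. Qed.

Let FS N : (F (N.+1%:R * h) = F (N%:R * h) +
  \int[mu]_(t in `](N%:R * h)%R, (N.+1%:R * h)%R]) (delta t)%:E)%E.
Proof.
have h1 : 0 <= N%:R * h by rewrite mulr_ge0// ltW.
have h2 : N%:R * h <= N.+1%:R * h by rewrite ler_pM2r// ler_nat.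
rewrite /F -ge0_integral_setU//=.
- by rewrite -itv_bndbnd_setU ?bnd_simp.
- exact: mdelta.
- by move=> t [|]; rewrite in_itv/= => /andP[t0 _]; rewrite lee_fin age_ge0//
    (le_trans h1)// ltW.
- apply/disj_setPS => t [/=]; rewrite !in_itv/= => /andP[_ tN] /andP[Nt _].
  by move: Nt; rewrite ltNge tN.
Qed.

Let mu_step N : (mu (`](N%:R * h)%R, (N.+1%:R * h)%R]%classic : set R) = h%:E)%E.
Proof.
rewrite lebesgue_measure_itv/= lte_fin ltr_pM2r// ltr_nat leqnn -EFinB.
by rewrite -natr1 mulrDl mul1r addrAC subrr add0r.
Qed.

Lemma integral_age_le N :
  (F (N%:R * h) <= (\sum_(k < N) h * (delta (k%:R * h) + h))%:E)%E.
Proof.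
elim: N => [|N IH].
  by rewrite big_ord0 mul0r /F set_itv1 integral_set1.
rewrite FS big_ord_recr/= EFinD leeD// [in leRHS]mulrC EFinM -(mu_step N).
rewrite -integral_cst//; apply: ge0_le_integral => //.
- move=> t /=; rewrite in_itv/= => /andP[Nt _].
  by rewrite lee_fin age_ge0// (le_trans _ (ltW Nt))// mulr_ge0// ltW.
- exact: mdelta.
- move=> t /=; rewrite in_itv/= => /andP[Nt tN]; rewrite lee_fin.
  rewrite (le_trans (age_growth (ltW Nt)))// lerD2l lerBlDr addrC.
  by move: tN; rewrite -natr1 mulrDl mul1r.
Qed.

(** The age grows at most at rate 1, so on each cell it is at least its final value minus [h]. The
    error stands on the right to keep the integrands nonnegative. *)
Lemma integral_age_ge N :
  ((\sum_(k < N) h * delta (k.+1%:R * h))%:E <=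
   F (N%:R * h) + (N%:R * (h * h))%:E)%E.
Proof.
elim: N => [|N IH].
  by rewrite big_ord0 !mul0r /F set_itv1 integral_set1 adde0.
have -> : ((N.+1%:R * (h * h))%:E = (N%:R * (h * h))%:E + (h * h)%:E)%E.
  by rewrite -EFinD -natr1 mulrDl mul1r.
rewrite FS big_ord_recr/= EFinD addeACA leeD//.
rewrite mulrC EFinM -(mu_step N) -integral_cst//.
rewrite [X in (_ <= _ + X)%E](_ : _ =
    (\int[mu]_(t in `](N%:R * h)%R, (N.+1%:R * h)%R]) (cst h%:E t))%E); last first.
  by rewrite integral_cst// EFinM; congr (_ * _)%E; exact/esym/mu_step.
rewrite -ge0_integralD//; last 3 first.
- move=> t /=; rewrite in_itv/= => /andP[Nt _].
  by rewrite lee_fin age_ge0// (le_trans _ (ltW Nt))// mulr_ge0// ltW.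
- exact: mdelta.
- by move=> t _; rewrite lee_fin ltW.
apply: ge0_le_integral => //.
- by move=> t _; rewrite lee_fin age_ge0// mulr_ge0// ltW.
- by apply: emeasurable_funD => //; exact: mdelta.
- move=> t /=; rewrite in_itv/= => /andP[Nt tN]; rewrite -EFinD lee_fin.
  rewrite (le_trans (age_growth tN))// lerD2l lerBlDr.
  by rewrite -natr1 mulrDl mul1r addrC lerD2l ltW.
Qed.

Let F_nondecreasing s t : s <= t -> (F s <= F t)%E.
Proof.
move=> st; apply: ge0_subset_integral => //.
- exact: mdelta.
- by move=> x /=; rewrite in_itv/= => /andP[x0 _]; rewrite lee_fin age_ge0.
- by move=> x /=; rewrite !in_itv/= => /andP[-> /le_trans->].
Qed.

Let F_ge0 t : (0 <= F t)%E.
Proof.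
apply: integral_ge0 => x /=; rewrite in_itv/= => /andP[x0 _].
by rewrite lee_fin age_ge0.
Qed.

(** Above, [3 * h] pays for rounding the age to a count, for its growth over a cell and for the
    deviation of the averages from [c]. Below, it pays for the gap between [g] and [h * c], for the
    growth and for the deviation. *)
Lemma avg_age_near (c g : R) : (\sum_(k < n) age_count k) / n%:R @[n --> \oo] --> c ->
  h * c <= g -> g <= h + h * c ->
  \forall t \near +oo, exists2 r, avg_age_upto A S t = r%:E & `|r - g| <= 3 * h.
Proof.
set U := fun n => \sum_(k < n) age_count k => cU cg gc.
have U0 m : 0 <= U m by do 2 (apply: sumr_ge0 => ? _); exact: ler0n.
(* The last condition absorbs the ratio of [m + 1] to [m]: it gives
   [(m + 1) * (c + 5/2) <= m * (c + 3)]. *)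
have [N _ HN] : \forall m \near \oo,
    [/\ c - 2^-1 <= U m / m%:R, U m / m%:R <= c + 2^-1 & 2 * (c + 3) <= m%:R].
  near=> m; split.
  - by near: m; apply: (cvgr_ge _ cU); lra.
  - by near: m; apply: (cvgr_le _ cU); lra.
  - by near: m; exact: nbhs_infty_ger.
near=> t.
have tN : N.+1%:R * h <= t by near: t; apply: nbhs_pinfty_ge; exact: num_real.
have t0 : 0 < t by rewrite (lt_le_trans _ tN)// mulr_gt0.
pose m := Num.truncn (t / h).
have /andP[mt tm] := truncn_itv (ltW (divr_gt0 t0 h0)).
rewrite -/m ler_pdivlMr// in mt; rewrite -/m ltr_pdivrMr// in tm.
have Nm : (N < m)%N.
  by rewrite /m truncn_gt_nat ler_pdivlMr.
have m0 : (0 < m)%N by rewrite (leq_ltn_trans _ Nm).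
have [lo up big] := HN m.+1 (leq_trans (ltnW Nm) (leqnSn m)).
have [_ _ bigm] := HN m (ltnW Nm).
pose M : R := m%:R; have M0 : 0 < M by rewrite ltr0n.
have M1E : m.+1%:R = M + 1 :> R by rewrite natr1.
pose a := U m.+1 / m.+1%:R.
have UE : U m.+1 = a * (M + 1) by rewrite /a M1E divfK// gt_eqF// ltr_wpDr.
have a0 : 0 <= a by rewrite divr_ge0.
rewrite -/a in lo up; rewrite -/M in bigm; rewrite M1E in tm; rewrite -/M in mt.
have Fup : (F t <= (h * h * (M + 1) * (a + 2))%:E)%E.
  apply: (le_trans (F_nondecreasing (_ : t <= m.+1%:R * h))).
    by rewrite M1E ltW.
  apply: (le_trans (integral_age_le _)); rewrite lee_fin.
  rewrite -mulr_sumr -!mulrA ler_wpM2l ?(ltW h0)//.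
  rewrite (@le_trans _ _ (\sum_(k < m.+1) (h * age_count k + h + h)))//.
    by apply: ler_sum => k _; rewrite lerD2r; have /andP[] := age_count_bounds k.
  rewrite !big_split/= -mulr_sumr -/(U m.+1) UE !sumr_const !card_ord.
  by rewrite -!(mulr_natr h) M1E le_eqVlt; apply/orP; left; apply/eqP; ring.
have Flo : ((h * h * (a * (M + 1) - M))%:E <= F t)%E.
  apply: le_trans (F_nondecreasing mt).
  rewrite -(leeD2rE _ _ (_ : (M * (h * h))%:E \is a fin_num))//.
  apply: le_trans (integral_age_ge m); rewrite -mulr_sumr -EFinD lee_fin.
  rewrite -UE (_ : h * h * _ + _ = h * (h * U m.+1)); last by ring.
  (* [age_count 0] is an empty sum, so [U m.+1] consists of the counts at the right ends of the [m]
     cells. *)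
  rewrite ler_wpM2l ?(ltW h0)// /U big_ord_recl/= {1}/age_count big_ord0 add0r.
  rewrite mulr_sumr; apply: ler_sum => k _.
  by have /andP[] := age_count_bounds k.+1.
have /fineK FE : F t \is a fin_num.
  by rewrite ge0_fin_numE// (le_lt_trans Fup)// ltry.
move: Fup Flo; rewrite -FE !lee_fin; set I := fine _ => Fup Flo.
have I0 : 0 <= I by rewrite -lee_fin FE.
exists (t^-1 * I); first by rewrite /avg_age_upto EFinM FE.
rewrite (mulrC t^-1) ler_distl; apply/andP; split.
  (* Replacing [t] by its upper bound [(M + 1) * h] requires a nonnegative factor [g - 3 * h]. *)
  case: (leP (g - 3 * h) 0) => g3.
    by rewrite (le_trans g3)// divr_ge0// ltW.
  rewrite ler_pdivlMr//.
  apply: le_trans Flo; apply: (@le_trans _ _ ((g - 3 * h) * ((M + 1) * h))).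
    by rewrite ler_wpM2l ?(ltW g3)// ltW.
  apply: (@le_trans _ _ (h * (c - 2) * ((M + 1) * h))).
    by rewrite ler_wpM2r ?mulr_ge0 ?addr_ge0 ?(ltW h0) ?(ltW M0)//; lra.
  rewrite (_ : h * (c - 2) * _ = h * h * ((c - 2) * (M + 1))); last by ring.
  rewrite ler_wpM2l ?mulr_ge0 ?(ltW h0)//.
  have := ler_wpM2r (addr_ge0 (ltW M0) ler01) lo; lra.
rewrite ler_pdivrMr//.
apply: (le_trans Fup); apply: (@le_trans _ _ ((g + 3 * h) * (M * h))).
  apply: (@le_trans _ _ (h * (c + 3) * (M * h))); last first.
    by rewrite ler_wpM2r ?mulr_ge0 ?(ltW h0) ?(ltW M0)//; lra.
  rewrite (_ : h * (c + 3) * _ = h * h * ((c + 3) * M)); last by ring.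
  rewrite -mulrA ler_wpM2l ?mulr_ge0 ?(ltW h0)//.
  have := ler_wpM2l (addr_ge0 (ltW M0) ler01) up; lra.
rewrite ler_wpM2l//.
have : 0 <= h * (c + 3) by rewrite mulr_ge0 ?(ltW h0)//; lra.
lra.
Unshelve. all: by end_near. Qed.

End sample_path.

Lemma stale_indic_age d (T : measurableType d) (R : realType)
    (P : probability T R) (A S : 'I_2 -> nat -> {RV P >-> R}) (h : R) i k w :
  0 <= h -> (i < k)%N -> (forall j k, 0 < S j k w) ->
  stale_indic A S h i k w = (i.+1%:R * h <=
    age (fun j k => A j k w) (fun j k => S j k w) (k%:R * h))%R%:R.
Proof.
move=> h0 ik S0; rewrite /stale_indic indicE; congr (_ _)%:R.
have xt : i.+1%:R * h <= k%:R * h by rewrite ler_wpM2r// ler_nat.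
apply/idP/idP; rewrite inE.
  move=> H; apply/(age_ge _ S0 xt) => j m.
  rewrite -mulrBl -natrB//; exact: H.
move=> /(age_ge _ S0 xt) H j m.
rewrite natrB// mulrBl; exact: H.
Qed.

Theorem theorem5 (d : measure_display) (T : measurableType d) (R : realType)
  (P : probability T R) (lam mu : 'I_2 -> R)
  (A S : 'I_2 -> nat -> {RV P >-> R}) :
  (forall j, 0 < lam j) -> (forall j, 0 < mu j) ->
  (forall j k, is_exponential P (A j k) (lam j)) ->
  (forall j k, is_exponential P (S j k) (mu j)) ->
  mutually_independent P
    (fun x : ('I_2 * nat) + ('I_2 * nat) =>
       match x with
       | inl (j, k) => (A j k : T -> R)
       | inr (j, k) => (S j k : T -> R)
       end) ->
  let l1 := lam ord0 in let l2 := lam (lift ord0 ord0) in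
  let m1 := mu ord0 in let m2 := mu (lift ord0 ord0) in
  {ae P, forall w : T,
    avg_age_upto (fun j k => A j k w) (fun j k => S j k w) Tm
      @[Tm --> +oo] -->
    ((m1 + m2)^-1 + (l1 + l2)^-1
     + ((m1 + m2) * (l1 + l2))^-1
       * (m1 * l2 / (l1 + m2) + m2 * l1 / (l2 + m1)))%:E}.
Proof.
move=> lam0 mu0 lawA lawS indep l1 l2 m1 m2.
rewrite -age_tail_integral0 /l1 /l2 /m1 /m2//.
set g := age_tail_integral _ _ _ _ _.
pose step m : R := m.+1%:R^-1.
have step0 m : 0 < step m by rewrite /step invr_gt0.
(* Countably many meshes, so that a single almost sure event serves them all. *)
have [c /all_and3[cg gc aec]] := choice (fun m =>
  ae_average_stale_count lam0 mu0 lawA lawS indep (step0 m)).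
apply: filterS2 (ae_positive lawA lawS) (ae_foralln aec) => w [_ S0] cvgc.
pose a := avg_age_upto (fun j k => A j k w) (fun j k => S j k w).
have near_g m : \forall t \near +oo, exists2 r, a t = r%:E & `|r - g| <= 3 * step m.
  apply: (avg_age_near S0 (step0 m) _ (cg m) (gc m)).
  rewrite [X in X @ _ --> _](_ : _ = fun n =>
    (\sum_(k < n) stale_count A S (step m) k w) / n%:R); first exact: cvgc.
  apply/funext => n; congr (_ / _); apply: eq_bigr => k _; apply: eq_bigr => i _.
  by rewrite stale_indic_age// ltW.
(* The average is an extended real, finite for large times; convergence is then proved in the
   reals. *)
have aE : {near +oo, EFin \o (fine \o a) =1 a}.
  by apply: filterS (near_g 0%N) => t [r rE _] /=; rewrite rE.
apply: cvg_trans (near_eq_cvg aE) _.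
apply: cvg_EFin; first by near=> t.
apply/cvgrPdist_le => /= e e0.
pose m := Num.truncn (3 / e).
have me : 3 * step m <= e.
  by rewrite ler_pdivrMr// mulrC -ler_pdivrMr// ltW// truncnS_gt.
apply: filterS (near_g m) => t [r rE rg].
by rewrite /= rE/= distrC (le_trans rg).
Unshelve. all: by end_near. Qed.
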